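(* Let $k$ be a field, $\mathfrak S$ a $k$-linear Grothendieck category that is locally finitely generated, $C$ a $k$-coalgebra and $A$ a $k$-algebra. Let $\beta:C\otimes A\to k$ be an $\mathfrak S$-rational pairing. Then the category $\mathfrak S^C$ of right $C$-comodule objects in $\mathfrak S$ is locally finitely generated.
   Context: Write $\otimes=\otimes_k$. For $\mathcal M\in\mathfrak S$ and a $k$-vector space $V$, $\mathcal M\otimes V\in\mathfrak S$ is defined by letting $\mathcal M\otimes-:k\text{-Mod}\to\mathfrak S$ be the left adjoint of $\mathfrak S(\mathcal M,-):\mathfrak S\to k\text{-Mod}$. The functor $-\otimes V:\mathfrak S\to\mathfrak S$ has a right adjoint $\underline{Hom}(V,-):\mathfrak S\to\mathfrak S$. $\mathfrak S^C$ is the category of right $C$-comodule objects in $\mathfrak S$: objects $\mathcal P\in\mathfrak S$ with a coassociative counital coaction $\Delta_{\mathcal P}:\mathcal P\to\mathcal P\otimes C$; morphisms are the morphisms in $\mathfrak S$ compatible with the coactions. A pairing is a $k$-linear map $\beta:C\otimes A\to k$ whose induced map $A\to C^*$ is a morphism of $k$-algebras, where $C^*$ has the convolution product $(f*g)(c)=\sum f(c_1)g(c_2)$. It is $\mathfrak S$-rational if for every $\mathcal M\in\mathfrak S$ the morphism $\alpha_{\mathcal M}:\mathcal M\otimes C\to\underline{Hom}(A,\mathcal M)$ corresponding by adjunction to $\mathcal M\otimes\beta:\mathcal M\otimes C\otimes A\to\mathcal M$ is a monomorphism in $\mathfrak S$. An object $X$ of a Grothendieck category is finitely generated if $\mathrm{Hom}(X,-)$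 preserves filtered colimits of systems of monomorphisms; a Grothendieck category is locally finitely generated if it has a set of finitely generated generators. *)

(* Defs.v *)
From HB Require Import structures.
From mathcomp Require Import all_boot all_algebra.
From mathcomp Require Import boolp.
Set Implicit Arguments.
Unset Strict Implicit.
Unset Printing Implicit Defensive.
Import GRing.Theory.
Local Open Scope ring_scope.

(* Size conventions: hom spaces are k-modules in the sense of MathComp, index
   sets and index categories live in the same universe as the carriers of those
   modules, and objects of categories live one universe higher.  The universe of
   [small] must not be allowed to float: larger index sets would make "all small
   coproducts" contradictory, and smaller ones would weaken it. *)
Notation small := (Type@{GRing.Lmodule.axioms_.u0}) (only parsing).
Notation large := (Type@{GRing.Lmodule.type.u0}) (only parsing).

(* Tensor product of k-modules: formal sums of pairs (v, w), identified when every
   bilinear map takes the same value on them. The universal property is given by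
   [tfactor], [tfactorE] and [tprod_ext]. *)
Section TensorProduct.
Variables (k : fieldType) (V W : lmodType k).
Local Open Scope quotient_scope.

Definition tsum (U : lmodType k) (f : V -> W -> U) (s : seq (V * W)) : U :=
  \sum_(p <- s) f p.1 p.2.

Definition teqv (s t : seq (V * W)) : bool :=
  `[< forall (U : lmodType k) (f : {bilinear V -> W -> U}), tsum f s = tsum f t >].

Lemma teqvP s t : reflect
  (forall (U : lmodType k) (f : {bilinear V -> W -> U}), tsum f s = tsum f t)
  (teqv s t).
Proof. exact: asboolP. Qed.

Lemma teqv_refl : reflexive teqv. Proof. by move=> s; apply/teqvP. Qed.
Lemma teqv_sym : symmetric teqv.
Proof. by move=> s t; apply/teqvP/teqvP => h U f; rewrite h. Qed.
Lemma teqv_trans : transitive teqv.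
Proof. by move=> t s u /teqvP h /teqvP h'; apply/teqvP => U f; rewrite h. Qed.

Canonical teqv_equiv := EquivRel teqv teqv_refl teqv_sym teqv_trans.

Definition tprod_type := {eq_quot teqv}.
HB.instance Definition _ := Choice.on tprod_type.
HB.instance Definition _ := EqQuotient.on tprod_type.

Implicit Types x y z : tprod_type.

Definition tfactor_fun (U : lmodType k) (f : V -> W -> U) x : U :=
  tsum f (repr x).

Lemma tfactor_pi (U : lmodType k) (f : {bilinear V -> W -> U}) s :
  tfactor_fun f (\pi_tprod_type s) = tsum f s.
Proof.
have /eqmodP /teqvP : repr (\pi_tprod_type s) = s %[mod tprod_type] by rewrite reprK.
exact.
Qed.

Lemma tprod_eq x y :
  (forall (U : lmodType k) (f : {bilinear V -> W -> U}),
     tfactor_fun f x = tfactor_fun f y) -> x = y.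
Proof. by move=> h; rewrite -[x]reprK -[y]reprK; apply/eqmodP/teqvP => U f; apply: h. Qed.

Definition tprod_zero : tprod_type := \pi_tprod_type [::].
Definition tprod_add x y : tprod_type := \pi_tprod_type (repr x ++ repr y).
Definition tprod_scale (a : k) x : tprod_type :=
  \pi_tprod_type [seq (a *: p.1, p.2) | p <- repr x].
Definition tprod_opp x := tprod_scale (-1) x.

Lemma tfactor0 (U : lmodType k) (f : {bilinear V -> W -> U}) :
  tfactor_fun f tprod_zero = 0.
Proof. by rewrite tfactor_pi /tsum big_nil. Qed.

Lemma tfactorD (U : lmodType k) (f : {bilinear V -> W -> U}) x y :
  tfactor_fun f (tprod_add x y) = tfactor_fun f x + tfactor_fun f y.
Proof. by rewrite tfactor_pi /tsum big_cat. Qed.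

Lemma tfactorZ (U : lmodType k) (f : {bilinear V -> W -> U}) a x :
  tfactor_fun f (tprod_scale a x) = a *: tfactor_fun f x.
Proof.
rewrite tfactor_pi /tsum big_map scaler_sumr; apply: eq_bigr => p _ /=.
by rewrite linearZl_LR.
Qed.

Definition tfactorS :=
  (tfactor0, tfactorD, tfactorZ).

Fact tprod_addA : associative tprod_add.
Proof. by move=> x y z; apply: tprod_eq => U f; rewrite !tfactorS addrA. Qed.
Fact tprod_addC : commutative tprod_add.
Proof. by move=> x y; apply: tprod_eq => U f; rewrite !tfactorS addrC. Qed.
Fact tprod_add0 : left_id tprod_zero tprod_add.
Proof. by move=> x; apply: tprod_eq => U f; rewrite !tfactorS add0r. Qed.
Fact tprod_addN : left_inverse tprod_zero tprod_opp tprod_add.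
Proof. by move=> x; apply: tprod_eq => U f; rewrite !tfactorS scaleN1r addNr. Qed.

HB.instance Definition _ := GRing.isZmodule.Build tprod_type
  tprod_addA tprod_addC tprod_add0 tprod_addN.

Fact tprod_scaleA a b x : tprod_scale a (tprod_scale b x) = tprod_scale (a * b) x.
Proof. by apply: tprod_eq => U f; rewrite !tfactorS scalerA. Qed.
Fact tprod_scale1 : left_id 1 tprod_scale.
Proof. by move=> x; apply: tprod_eq => U f; rewrite !tfactorS scale1r. Qed.
Fact tprod_scaleDr : right_distributive tprod_scale +%R.
Proof. by move=> a x y; apply: tprod_eq => U f; rewrite !tfactorS scalerDr. Qed.
Fact tprod_scaleDl x : {morph tprod_scale^~ x : a b / a + b}.
Proof. by move=> a b; apply: tprod_eq => U f; rewrite !tfactorS scalerDl. Qed.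

HB.instance Definition _ := GRing.Zmodule_isLmodule.Build k tprod_type
  tprod_scaleA tprod_scale1 tprod_scaleDr tprod_scaleDl.

Definition tprod : lmodType k := GRing.Lmodule.clone k tprod_type _.

Definition tens (v : V) (w : W) : tprod := \pi_tprod_type [:: (v, w)].

Lemma tfactor_tens (U : lmodType k) (f : {bilinear V -> W -> U}) v w :
  tfactor_fun f (tens v w) = f v w.
Proof. by rewrite tfactor_pi /tsum big_seq1. Qed.

Fact tens_is_bilinear : bilinear_for *:%R *:%R tens.
Proof.
split=> u a x y; apply: tprod_eq => U f;
  by rewrite tfactorD tfactorZ !tfactor_tens (linearPl, linearPr).
Qed.
HB.instance Definition _ := bilinear_isBilinear.Build k V W tprod
  *:%R *:%R tens tens_is_bilinear.

Section Factor.
Variables (U : lmodType k) (f : {bilinear V -> W -> U}).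
Definition tfactor (x : tprod) : U := tfactor_fun f x.
Fact tfactor_is_linear : linear tfactor.
Proof. by move=> a x y; rewrite /tfactor tfactorD tfactorZ. Qed.
HB.instance Definition _ := GRing.isLinear.Build k tprod U *:%R tfactor
  tfactor_is_linear.

Lemma tfactorE v w : tfactor (tens v w) = f v w.
Proof. exact: tfactor_tens. Qed.
End Factor.

Lemma tprod_sum (x : tprod) : exists s : seq (V * W), x = \sum_(p <- s) tens p.1 p.2.
Proof.
exists (repr (x : tprod_type)); apply: tprod_eq => U f.
rewrite {1}/tfactor_fun /tsum -[RHS]/(tfactor f _) linear_sum.
by apply: eq_bigr => p _; rewrite [RHS]tfactorE.
Qed.

Lemma tprod_ext (U : lmodType k) (f g : {linear tprod -> U}) :
  (forall v w, f (tens v w) = g (tens v w)) -> f =1 g.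
Proof.
move=> h x; have [s ->] := tprod_sum x.
by rewrite !linear_sum; apply: eq_bigr => p _.
Qed.

End TensorProduct.

Section TensorMaps.
Variable k : fieldType.

Section Map.
Variables (V V' W W' : lmodType k).
Variables (f : {linear V -> V'}) (g : {linear W -> W'}).
Definition tmap_pre v w : tprod V' W' := tens (f v) (g w).
Fact tmap_pre_is_bilinear : bilinear_for *:%R *:%R tmap_pre.
Proof. by split=> u a x y; rewrite /tmap_pre linearP ?linearPl ?linearPr. Qed.
HB.instance Definition _ := bilinear_isBilinear.Build k V W (tprod V' W')
  *:%R *:%R tmap_pre tmap_pre_is_bilinear.
Definition tmap : {linear tprod V W -> tprod V' W'} := tfactor tmap_pre.
End Map.

Section Assoc.
Variables (V W U : lmodType k).
Section Inner.
Variable u : U.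
Definition tassoc_in v w : tprod V (tprod W U) := tens v (tens w u).
Fact tassoc_in_is_bilinear : bilinear_for *:%R *:%R tassoc_in.
Proof.
by split=> z a x y; rewrite /tassoc_in linearPl ?linearPr.
Qed.
HB.instance Definition _ := bilinear_isBilinear.Build k V W
  (tprod V (tprod W U)) *:%R *:%R tassoc_in tassoc_in_is_bilinear.
End Inner.
Definition tassoc_out (t : tprod V W) u : tprod V (tprod W U) :=
  tfactor (tassoc_in u) t.
Fact tassoc_out_is_bilinear : bilinear_for *:%R *:%R tassoc_out.
Proof.
split=> [u|t] a x y; rewrite /tassoc_out ?linearP //.
have [s ->] := tprod_sum t.
rewrite !linear_sum /= scaler_sumr -big_split /=; apply: eq_bigr => p _.
by rewrite !tfactorE /= /tassoc_in !linearPr.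
Qed.
HB.instance Definition _ := bilinear_isBilinear.Build k (tprod V W) U
  (tprod V (tprod W U)) *:%R *:%R tassoc_out tassoc_out_is_bilinear.
Definition tassoc : {linear tprod (tprod V W) U -> tprod V (tprod W U)} :=
  tfactor tassoc_out.
End Assoc.

Section UnitMaps.
Variable V : lmodType k.
Definition tlunit_pre (a : k^o) (v : V) : V := a *: v.
Fact tlunit_pre_is_bilinear : bilinear_for *:%R *:%R tlunit_pre.
Proof.
split=> [v|b] a x y; rewrite /tlunit_pre /=.
  by rewrite /= scalerDl scalerA.
by rewrite scalerDr !scalerA mulrC.
Qed.
HB.instance Definition _ := bilinear_isBilinear.Build k k^o V V
  *:%R *:%R tlunit_pre tlunit_pre_is_bilinear.
Definition tlunit : {linear tprod k^o V -> V} := tfactor tlunit_pre.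

Definition trunit_pre (v : V) (a : k^o) : V := a *: v.
Fact trunit_pre_is_bilinear : bilinear_for *:%R *:%R trunit_pre.
Proof. by split=> u; [exact: tlunit_pre_is_bilinear.2 | exact: tlunit_pre_is_bilinear.1]. Qed.
HB.instance Definition _ := bilinear_isBilinear.Build k V k^o V
  *:%R *:%R trunit_pre trunit_pre_is_bilinear.
Definition trunit : {linear tprod V k^o -> V} := tfactor trunit_pre.
End UnitMaps.

End TensorMaps.

Record coalgebra (k : fieldType) := Coalgebra {
  coalg :> lmodType k;
  comul : {linear coalg -> tprod coalg coalg};
  counit : {linear coalg -> k^o};
  comulA : forall c,
    tassoc coalg coalg coalg (tmap comul idfun (comul c))
    = tmap idfun comul (comul c);
  counitl : forall c, tlunit coalg (tmap counit idfun (comul c)) = c;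
  counitr : forall c, trunit coalg (tmap idfun counit (comul c)) = c
}.

(* Associative unital k-algebras; unlike [algType], this allows the zero algebra. *)
Record algebra (k : fieldType) := Algebra {
  alg :> lmodType k;
  amul : {bilinear alg -> alg -> alg};
  aone : alg;
  amulA : associative amul;
  amul1l : left_id aone amul;
  amul1r : right_id aone amul
}.

Section Pairing.
Variables (k : fieldType) (C : coalgebra k).

Section Convolution.
Variables f g : {linear C -> k^o}.
Definition kmul (a b : k^o) : k^o := a * b.
Fact kmul_is_bilinear : bilinear_for *:%R *:%R kmul.
Proof.
by split=> u a x y; rewrite /kmul /= ?mulrDl ?mulrDr -?scalerAl -?scalerAr.
Qed.
HB.instance Definition _ := bilinear_isBilinear.Build k k^o k^o k^o
  *:%R *:%R kmul kmul_is_bilinear.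
Definition convolution : {linear C -> k^o} :=
  (tfactor kmul \o (tmap f g \o comul C))%FUN.
End Convolution.

Variables (A : algebra k) (beta : {linear tprod C A -> k^o}).

Definition pairing_dual (a : A) : C -> k^o := fun c => beta (tens c a).
Fact pairing_dual_is_linear a : linear (pairing_dual a).
Proof. by move=> b x y; rewrite /pairing_dual linearPl linearP. Qed.
HB.instance Definition _ a := GRing.isLinear.Build k C k^o *:%R (pairing_dual a)
  (pairing_dual_is_linear a).

(* [pairing_dual] is automatically k-linear in [a], so only the compatibility with
   the units and the products of A and of the convolution algebra is required. *)
Definition is_pairing : Prop :=
  pairing_dual (aone A) =1 counit C /\
  forall a b, pairing_dual (amul A a b) =1 convolution (pairing_dual a) (pairing_dual b).

End Pairing.

Record lincat (k : fieldType) := Lincat {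
  ob :> large;
  hom : ob -> ob -> lmodType k;
  idm : forall X, hom X X;
  comp : forall X Y Z, hom Y Z -> hom X Y -> hom X Z;
  comp_idl : forall X Y (f : hom X Y), comp (idm Y) f = f;
  comp_idr : forall X Y (f : hom X Y), comp f (idm X) = f;
  compA : forall X Y Z T (f : hom Z T) (g : hom Y Z) (h : hom X Y),
    comp f (comp g h) = comp (comp f g) h;
  comp_linearl : forall X Y Z (f : hom X Y),
    linear (fun g : hom Y Z => comp g f);
  comp_linearr : forall X Y Z (g : hom Y Z),
    linear (fun f : hom X Y => comp g f)
}.
Arguments hom {k l}.
Arguments idm {k l}.
Arguments comp {k l X Y Z}.
Notation "g ∘ f" := (comp g f) (at level 40, left associativity).

Section CompZero.
Variables (k : fieldType) (S : lincat k) (X Y Z : S).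
Lemma comp0l (f : hom X Y) : (0 : hom Y Z) ∘ f = 0.
Proof. by have := comp_linearl f (-1) (0 : hom Y Z) 0; rewrite scaler0 addr0 scaleN1r addNr. Qed.
Lemma comp0r (g : hom Y Z) : g ∘ (0 : hom X Y) = 0.
Proof. by have := comp_linearr g (-1) (0 : hom X Y) 0; rewrite scaler0 addr0 scaleN1r addNr. Qed.
End CompZero.

Record smallcat := Smallcat {
  sob :> small;
  shom : sob -> sob -> small;
  sidm : forall i, shom i i;
  scomp : forall i j l, shom j l -> shom i j -> shom i l;
  scomp_idl : forall i j (u : shom i j), scomp (sidm j) u = u;
  scomp_idr : forall i j (u : shom i j), scomp u (sidm i) = u;
  scompA : forall i j l m (u : shom l m) (v : shom j l) (w : shom i j),
    scomp u (scomp v w) = scomp (scomp u v) w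
}.

Definition filtered (J : smallcat) : Prop :=
  [/\ inhabited J,
      forall i j : J, exists l, inhabited (shom i l) /\ inhabited (shom j l) &
      forall (i j : J) (u v : shom i j),
        exists l (w : shom j l), scomp w u = scomp w v].

Section Grothendieck.
Variables (k : fieldType) (S : lincat k).

Definition is_mono (X Y : S) (f : hom X Y) : Prop :=
  forall Z (g h : hom Z X), f ∘ g = f ∘ h -> g = h.
Definition is_epi (X Y : S) (f : hom X Y) : Prop :=
  forall Z (g h : hom Y Z), g ∘ f = h ∘ f -> g = h.

Definition is_kernel (K X Y : S) (i : hom K X) (f : hom X Y) : Prop :=
  f ∘ i = 0 /\
  forall Z (g : hom Z X), f ∘ g = 0 -> exists! h : hom Z K, i ∘ h = g.
Definition is_cokernel (X Y Q : S) (f : hom X Y) (p : hom Y Q) : Prop :=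
  p ∘ f = 0 /\
  forall Z (g : hom Y Z), g ∘ f = 0 -> exists! h : hom Q Z, h ∘ p = g.

Definition has_zero_object : Prop :=
  exists O : S, (forall X (f g : hom X O), f = g) /\ (forall X (f g : hom O X), f = g).

Definition has_binary_products : Prop :=
  forall X Y : S, exists (P : S) (p : hom P X) (q : hom P Y),
    forall Z (f : hom Z X) (g : hom Z Y),
      exists! h : hom Z P, p ∘ h = f /\ q ∘ h = g.

Definition abelian : Prop :=
  [/\ has_zero_object /\ has_binary_products,
      forall (X Y : S) (f : hom X Y), exists (K : S) (i : hom K X), is_kernel i f,
      forall (X Y : S) (f : hom X Y), exists (Q : S) (p : hom Y Q), is_cokernel f p,
      forall (X Y : S) (f : hom X Y),
        is_mono f -> exists (Z : S) (g : hom Y Z), is_kernel f g &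
      forall (X Y : S) (f : hom X Y),
        is_epi f -> exists (Z : S) (g : hom Z X), is_cokernel g f].

Definition has_coproducts : Prop :=
  forall (I : small) (F : I -> S), exists (X : S) (inj : forall i, hom (F i) X),
    forall Y (g : forall i, hom (F i) Y),
      exists! h : hom X Y, forall i, h ∘ inj i = g i.

Record diagram (J : smallcat) := Diagram {
  dob :> J -> S;
  dmap : forall i j, shom i j -> hom (dob i) (dob j);
  dmap_id : forall i, dmap (sidm i) = idm (dob i);
  dmap_comp : forall i j l (u : shom j l) (v : shom i j),
    dmap (scomp u v) = dmap u ∘ dmap v
}.

Record cocone (J : smallcat) (D : diagram J) := Cocone {
  apex : S;
  leg : forall j, hom (D j) apex;
  legE : forall i j (u : shom i j), leg j ∘ dmap D u = leg i
}.

Definition is_colimit (J : smallcat) (D : diagram J) (c : cocone D) : Prop :=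
  forall c' : cocone D,
    exists! h : hom (apex c) (apex c'), forall j, h ∘ leg c j = leg c' j.

Definition short_exact (X Y Z : S) (f : hom X Y) (g : hom Y Z) : Prop :=
  is_kernel f g /\ is_cokernel f g.

Definition natural (J : smallcat) (D E : diagram J)
    (t : forall j, hom (D j) (E j)) : Prop :=
  forall i j (u : shom i j), t j ∘ dmap D u = dmap E u ∘ t i.

Definition filtered_colimits_exact : Prop :=
  forall (J : smallcat) (D E F : diagram J)
    (s : forall j, hom (D j) (E j)) (t : forall j, hom (E j) (F j))
    (cD : cocone D) (cE : cocone E) (cF : cocone F)
    (f : hom (apex cD) (apex cE)) (g : hom (apex cE) (apex cF)),
    filtered J -> natural s -> natural t ->
    (forall j, short_exact (s j) (t j)) ->
    is_colimit cD -> is_colimit cE -> is_colimit cF ->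
    (forall j, f ∘ leg cD j = leg cE j ∘ s j) ->
    (forall j, g ∘ leg cE j = leg cF j ∘ t j) ->
    short_exact f g.

Definition generating (I : small) (G : I -> S) : Prop :=
  forall (X Y : S) (f g : hom X Y),
    (forall i (h : hom (G i) X), f ∘ h = g ∘ h) -> f = g.

Definition grothendieck : Prop :=
  [/\ abelian, has_coproducts, filtered_colimits_exact &
      exists G : S, generating (fun _ : unit => G)].

(* The condition on W and phi is the universal property making the cocone
   Hom(X, D j) -> Hom(X, colim D) a colimit in the category of k-modules. *)
Definition finitely_generated (X : S) : Prop :=
  forall (J : smallcat) (D : diagram J) (c : cocone D),
    filtered J -> (forall i j (u : shom i j), is_mono (dmap D u)) -> is_colimit c ->
    forall (W : lmodType k) (phi : forall j, {linear hom X (D j) -> W}),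
      (forall i j (u : shom i j) (f : hom X (D i)), phi j (dmap D u ∘ f) = phi i f) ->
      exists psi : {linear hom X (apex c) -> W},
        (forall j f, psi (leg c j ∘ f) = phi j f) /\
        forall psi' : {linear hom X (apex c) -> W},
          (forall j f, psi' (leg c j ∘ f) = phi j f) -> psi' =1 psi.

Definition locally_finitely_generated : Prop :=
  grothendieck /\
  exists (I : small) (G : I -> S),
    generating G /\ forall i, finitely_generated (G i).

(* A choice, for every M, of a left adjoint M ⊗ - of S(M, -) : S -> k-Mod, given by
   universal arrows [ounit] : V -> S(M, M ⊗ V). *)
Record tensoring := Tensoring {
  otens : S -> lmodType k -> S;
  ounit : forall M (V : lmodType k), {linear V -> hom M (otens M V)};
  ofactor : forall M (V : lmodType k) N, {linear V -> hom M N} -> hom (otens M V) N;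
  ofactorE : forall M (V : lmodType k) N (phi : {linear V -> hom M N}) v,
    ofactor phi ∘ ounit M V v = phi v;
  otens_ext : forall M V N (f g : hom (otens M V) N),
    (forall v, f ∘ ounit M V v = g ∘ ounit M V v) -> f = g
}.

Variable T : tensoring.

Section TensoringMaps.

Section Left.
Variables (M N : S) (f : hom M N) (V : lmodType k).
Definition otensl_pre (v : V) : hom M (otens T N V) := ounit T N V v ∘ f.
Fact otensl_pre_is_linear : linear otensl_pre.
Proof. by move=> a x y; rewrite /otensl_pre linearP comp_linearl. Qed.
HB.instance Definition _ := GRing.isLinear.Build k V (hom M (otens T N V)) *:%R
  otensl_pre otensl_pre_is_linear.
Definition otensl : hom (otens T M V) (otens T N V) := ofactor T otensl_pre.
End Left.

Section Right.
Variables (M : S) (V W : lmodType k) (h : {linear V -> W}).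
Definition otensr : hom (otens T M V) (otens T M W) :=
  ofactor T (ounit T M W \o h)%FUN.
End Right.

Section OAssoc.
Variables (M : S) (V W : lmodType k).
Section Inner.
Variable w : W.
Definition oassoc_in (v : V) : hom M (otens T M (tprod V W)) :=
  ounit T M (tprod V W) (tens v w).
Fact oassoc_in_is_linear : linear oassoc_in.
Proof. by move=> a x y; rewrite /oassoc_in linearPl linearP. Qed.
HB.instance Definition _ := GRing.isLinear.Build k V
  (hom M (otens T M (tprod V W))) *:%R oassoc_in oassoc_in_is_linear.
End Inner.
Definition oassoc_out (w : W) : hom (otens T M V) (otens T M (tprod V W)) :=
  ofactor T (oassoc_in w).
Fact oassoc_out_is_linear : linear oassoc_out.
Proof.
move=> a x y; apply: otens_ext => v.
by rewrite comp_linearl !ofactorE /= /oassoc_in linearPr linearP.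
Qed.
HB.instance Definition _ := GRing.isLinear.Build k W
  (hom (otens T M V) (otens T M (tprod V W))) *:%R oassoc_out oassoc_out_is_linear.
(* The canonical isomorphism (M ⊗ V) ⊗ W -> M ⊗ (V ⊗ W). *)
Definition oassoc : hom (otens T (otens T M V) W) (otens T M (tprod V W)) :=
  ofactor T oassoc_out.
End OAssoc.

Section ORunit.
Variable M : S.
Definition orunit_pre (a : k^o) : hom M M := a *: idm M.
Fact orunit_pre_is_linear : linear orunit_pre.
Proof. by move=> a x y; rewrite /orunit_pre scalerDl scalerA. Qed.
HB.instance Definition _ := GRing.isLinear.Build k k^o (hom M M) *:%R
  orunit_pre orunit_pre_is_linear.
(* The canonical isomorphism M ⊗ k -> M. *)
Definition orunit : hom (otens T M k^o) M := ofactor T orunit_pre.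
End ORunit.

End TensoringMaps.

(* A choice, for every V, of a right adjoint Hom(V, -) of - ⊗ V : S -> S, given by
   universal arrows [oeval] : Hom(V, N) ⊗ V -> N. *)
Record cotensoring := Cotensoring {
  ohom : lmodType k -> S -> S;
  oeval : forall V N, hom (otens T (ohom V N) V) N;
  ocurry : forall V M N, hom (otens T M V) N -> hom M (ohom V N);
  ocurryE : forall V M N (f : hom (otens T M V) N),
    oeval V N ∘ otensl (ocurry f) V = f;
  ohom_ext : forall V M N (f g : hom M (ohom V N)),
    oeval V N ∘ otensl f V = oeval V N ∘ otensl g V -> f = g
}.

Section Rational.
Variables (H : cotensoring) (C : coalgebra k) (A : algebra k).
Variable beta : {linear tprod C A -> k^o}.

Definition pairing_mor (M : S) : hom (otens T M C) (ohom H A M) :=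
  ocurry H (orunit M ∘ otensr M beta ∘ oassoc M C A).

Definition is_rational : Prop := forall M : S, is_mono (pairing_mor M).
End Rational.

Section Comodules.
Variable C : coalgebra k.

Record comodule := Comodule {
  cmob :> S;
  coact : hom cmob (otens T cmob C);
  coactA : oassoc cmob C C ∘ otensl coact C ∘ coact = otensr cmob (comul C) ∘ coact;
  coact1 : orunit cmob ∘ otensr cmob (counit C) ∘ coact = idm cmob
}.

Section Hom.
Variables P Q : comodule.

Definition is_colinear : pred (hom (cmob P) (cmob Q)) :=
  fun f => coact Q ∘ f == otensl f C ∘ coact P.

Fact is_colinear_submod_closed : submod_closed is_colinear.
Proof.
have otenslP (a : k) (f g : hom (cmob P) (cmob Q)) :
    otensl (a *: f + g) C = a *: otensl f C + otensl g C.
  apply: otens_ext => v; rewrite comp_linearl !ofactorE /=.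
  by rewrite /otensl_pre comp_linearr.
have otensl0 : otensl (0 : hom (cmob P) (cmob Q)) C = 0.
  by have := otenslP (-1) 0 0; rewrite scaler0 addr0 scaleN1r addNr.
split=> [|a f g]; rewrite !unfold_in.
  by rewrite otensl0 comp0l comp0r.
by move=> /eqP hf /eqP hg; rewrite otenslP comp_linearl comp_linearr hf hg.
Qed.
HB.instance Definition _ := GRing.isSubmodClosed.Build k (hom (cmob P) (cmob Q))
  is_colinear is_colinear_submod_closed.

Record comodule_hom := ComoduleHom {
  cmhom :> hom (cmob P) (cmob Q);
  _ : is_colinear cmhom
}.
HB.instance Definition _ := [isSub for cmhom].
HB.instance Definition _ := [Choice of comodule_hom by <:].
HB.instance Definition _ := [SubChoice_isSubLmodule of comodule_hom by <:].

Lemma comodule_homP (f : comodule_hom) : coact Q ∘ f = otensl f C ∘ coact P.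
Proof. by case: f => f h; apply/eqP. Qed.
End Hom.

Lemma otensl_id (M : S) (V : lmodType k) : otensl (idm M) V = idm (otens T M V).
Proof.
by apply: otens_ext => v; rewrite ofactorE /= /otensl_pre comp_idl comp_idr.
Qed.

Lemma otensl_comp (M N L : S) (g : hom N L) (f : hom M N) (V : lmodType k) :
  otensl (g ∘ f) V = otensl g V ∘ otensl f V.
Proof.
apply: otens_ext => v.
by rewrite -compA !ofactorE /= /otensl_pre !compA !ofactorE.
Qed.

Fact comodule_id_colinear (P : comodule) : is_colinear (idm (cmob P)).
Proof. by apply/eqP; rewrite otensl_id comp_idl comp_idr. Qed.
Definition comodule_id (P : comodule) : comodule_hom P P :=
  ComoduleHom (comodule_id_colinear P).

Section Comp.
Variables (P Q R : comodule) (g : comodule_hom Q R) (f : comodule_hom P Q).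
Fact comodule_comp_colinear : is_colinear (g ∘ f).
Proof.
apply/eqP; rewrite compA comodule_homP -compA comodule_homP.
by rewrite compA otensl_comp.
Qed.
Definition comodule_comp : comodule_hom P R := ComoduleHom comodule_comp_colinear.
End Comp.

Definition comodule_cat : lincat k.
Proof.
refine (@Lincat k comodule (fun P Q => comodule_hom P Q) comodule_id comodule_comp
  _ _ _ _ _).
- by move=> P Q f; apply: val_inj; rewrite /= comp_idl.
- by move=> P Q f; apply: val_inj; rewrite /= comp_idr.
- by move=> P Q R L f g h; apply: val_inj; rewrite /= compA.
- move=> P Q R f a g h; apply: val_inj.
  rewrite linearP /=; exact: comp_linearl.
- move=> P Q R f a g h; apply: val_inj.
  rewrite linearP /=; exact: comp_linearr.
Defined.

End Comodules.
End Grothendieck.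

(* Main.v *)
(* A pairing makes every comodule P an A-module object, the element a acting by
   P -> P ⊗ C -> P with second map P ⊗ beta(-, a). Rationality says that the maps
   M ⊗ beta(-, a) are jointly monic on M ⊗ C, for every M; hence A-linear maps of
   comodules are colinear, and A-stable subobjects of comodules are subcomodules
   (apply joint monicity to the quotient, and use that - ⊗ C preserves kernels).
   So for G in S and h : G -> P the image of the induced map G ⊗ A -> P is a
   subcomodule through which h factors. When G is finitely generated, so is any
   comodule X with an A-linear epimorphism G ⊗ A -> X: a map from X to a filtered
   union is determined by the image of G, which lies in one of the terms. Such
   quotients of G ⊗ A, for G in a generating family, therefore generate.

   That comodules form a Grothendieck category holds because the forgetful functor
   to S creates colimits, and also kernels: - ⊗ C is left exact by AB5, as a vector
   space is a filtered colimit of finite-dimensional ones. *)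

From HB Require Import structures.
From mathcomp Require Import all_boot all_algebra.
From mathcomp Require Import boolp.
Require Import Defs.
Set Implicit Arguments.
Unset Strict Implicit.
Unset Printing Implicit Defensive.
Import GRing.Theory.
Local Open Scope ring_scope.

Lemma choice_dep (I : Type) (B : I -> Type) (P : forall i, B i -> Prop) :
  (forall i, exists b, P i b) -> exists f : forall i, B i, forall i, P i (f i).
Proof. by move=> h; exists (fun i => sval (cid (h i))) => i; exact: (svalP (cid (h i))). Qed.

(** * Linear categories: kernels, cokernels, coproducts *)

Section LinearCategory.
Variables (k : fieldType) (S : lincat k).

Section CompLinear.
Variables X Y Z : S.

(** Named so that composition carries a canonical linear structure and the library lemmas on linear
    maps apply to it. *)
Definition precomp (f : hom X Y) : hom Y Z -> hom X Z := fun g => g ∘ f.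
HB.instance Definition _ f := GRing.isLinear.Build k (hom Y Z) (hom X Z) *:%R
  (precomp f) (comp_linearl f).

Definition postcomp (g : hom Y Z) : hom X Y -> hom X Z := fun f => g ∘ f.
HB.instance Definition _ g := GRing.isLinear.Build k (hom X Y) (hom X Z) *:%R
  (postcomp g) (comp_linearr g).

Lemma compBl (g h : hom Y Z) (f : hom X Y) : (g - h) ∘ f = g ∘ f - h ∘ f.
Proof. exact: (linearB (precomp f)). Qed.

Lemma compBr (g : hom Y Z) (f h : hom X Y) : g ∘ (f - h) = g ∘ f - g ∘ h.
Proof. exact: (linearB (postcomp g)). Qed.

Lemma compDl (g h : hom Y Z) (f : hom X Y) : (g + h) ∘ f = g ∘ f + h ∘ f.
Proof. exact: (linearD (precomp f)). Qed.

Lemma compDr (g : hom Y Z) (f h : hom X Y) : g ∘ (f + h) = g ∘ f + g ∘ h.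
Proof. exact: (linearD (postcomp g)). Qed.

Lemma compZl a (g : hom Y Z) (f : hom X Y) : (a *: g) ∘ f = a *: (g ∘ f).
Proof. exact: (linearZZ (precomp f) a). Qed.

Lemma compZr a (g : hom Y Z) (f : hom X Y) : g ∘ (a *: f) = a *: (g ∘ f).
Proof. exact: (linearZZ (postcomp g) a). Qed.

Lemma comp_suml (I : Type) (r : seq I) (g : I -> hom Y Z) (f : hom X Y) :
  (\sum_(i <- r) g i) ∘ f = \sum_(i <- r) (g i ∘ f).
Proof. exact: (linear_sum (precomp f)). Qed.

End CompLinear.

Lemma monoP (X Y : S) (f : hom X Y) :
  is_mono f <-> forall Z (g : hom Z X), f ∘ g = 0 -> g = 0.
Proof.
split=> [mf Z g fg|h Z g g' e]; first by apply: mf; rewrite fg comp0r.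
by apply/eqP; rewrite -subr_eq0; apply/eqP/h; rewrite compBr e subrr.
Qed.

Lemma epiP (X Y : S) (f : hom X Y) :
  is_epi f <-> forall Z (g : hom Y Z), g ∘ f = 0 -> g = 0.
Proof.
split=> [ef Z g fg|h Z g g' e]; first by apply: ef; rewrite fg comp0l.
by apply/eqP; rewrite -subr_eq0; apply/eqP/h; rewrite compBl e subrr.
Qed.

Lemma mono_comp (X Y Z : S) (g : hom Y Z) (f : hom X Y) :
  is_mono g -> is_mono f -> is_mono (g ∘ f).
Proof. by move=> mg mf W u v; rewrite -!compA => /mg /mf. Qed.

Lemma kernelP (K X Y : S) (i : hom K X) (f : hom X Y) :
  is_kernel i f <->
  [/\ is_mono i, f ∘ i = 0 &
      forall Z (g : hom Z X), f ∘ g = 0 -> exists h : hom Z K, i ∘ h = g].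
Proof.
split=> [[fi u]|[mi fi u]]; last first.
  split=> // Z g /u[h ih]; exists h; split=> // h' ih'.
  by apply: mi; rewrite ih ih'.
split=> // [Z g h e|Z g /u[h [ih _]]]; last by exists h.
have /u[z [_ uz]] : f ∘ (i ∘ g) = 0 by rewrite compA fi comp0l.
by rewrite -(uz g) // (uz h).
Qed.

Lemma cokernelP (X Y Q : S) (f : hom X Y) (p : hom Y Q) :
  is_cokernel f p <->
  [/\ is_epi p, p ∘ f = 0 &
      forall Z (g : hom Y Z), g ∘ f = 0 -> exists h : hom Q Z, h ∘ p = g].
Proof.
split=> [[pf u]|[ep pf u]]; last first.
  split=> // Z g /u[h hp]; exists h; split=> // h' hp'.
  by apply: ep; rewrite hp hp'.
split=> // [Z g h e|Z g /u[h [hp _]]]; last by exists h.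
have /u[z [_ uz]] : (g ∘ p) ∘ f = 0 by rewrite -compA pf comp0r.
by rewrite -(uz g) // (uz h).
Qed.

(** The coproduct of X and Y is also their product: the projections are the identity on one summand
    and zero on the other, and [i ∘ p + j ∘ q] is the identity because it is so on both
    injections. *)
Lemma coproducts_binary_products : has_coproducts S -> has_binary_products S.
Proof.
move=> hS X Y.
have [P [inj u]] := hS bool (fun b => if b then X else Y).
have ext Z (f g : hom P Z) : (forall b, f ∘ inj b = g ∘ inj b) -> f = g.
  by move=> e; have [h [_ uh]] := u Z (fun b => f ∘ inj b); rewrite -(uh f) // (uh g).
have [p [pE _]] := u X (fun b =>
  if b as b return hom (if b then X else Y) X then idm X else 0).
have [q [qE _]] := u Y (fun b =>
  if b as b return hom (if b then X else Y) Y then 0 else idm Y).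
pose i : hom X P := inj true; pose j : hom Y P := inj false.
have pi : p ∘ i = idm X := pE true.
have pj : p ∘ j = 0 := pE false.
have qi : q ∘ i = 0 := qE true.
have qj : q ∘ j = idm Y := qE false.
have id_sum : i ∘ p + j ∘ q = idm P.
  apply: ext => -[].
    by rewrite compDl -!compA -/i pi qi comp_idl comp_idr comp0r addr0.
  by rewrite compDl -!compA -/j pj qj comp_idl comp_idr comp0r add0r.
exists P, p, q => Z f g; exists (i ∘ f + j ∘ g); split.
  by rewrite !compDr !compA pi pj qi qj !comp0l !comp_idl addr0 add0r.
by move=> h [<- <-]; rewrite -[RHS]comp_idl -id_sum compDl !compA.
Qed.

Lemma coproduct_ext (I : small) (F : I -> S) (X : S) (inj : forall i, hom (F i) X) :
  (forall Y (g : forall i, hom (F i) Y),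
     exists! h : hom X Y, forall i, h ∘ inj i = g i) ->
  forall Y (f g : hom X Y), (forall i, f ∘ inj i = g ∘ inj i) -> f = g.
Proof.
move=> u Y f g e; have [h [_ uh]] := u Y (fun i => g ∘ inj i).
by rewrite -(uh f) // (uh g).
Qed.

Lemma colimit_ext (J : smallcat) (D : diagram S J) (c : cocone D) Y
    (f g : hom (apex c) Y) :
  is_colimit c -> (forall j, f ∘ leg c j = g ∘ leg c j) -> f = g.
Proof.
move=> cc e.
have gE i j (u : shom i j) : g ∘ leg c j ∘ dmap D u = g ∘ leg c i.
  by rewrite -compA legE.
have [h [_ uh]] := cc (Cocone gE); by rewrite -(uh f) // (uh g).
Qed.

(** The coproduct of the family works: a map from one summand extends by zero to the whole
    coproduct. *)
Lemma coproduct_generator (I : small) (G : I -> S) :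
  has_coproducts S -> generating G ->
  exists X : S, generating (fun _ : unit => X).
Proof.
move=> hS gG; have [X [inj u]] := hS I G; exists X => Y Z f g e.
apply: gG => i h.
have [m [mE _]] := u Y (fun j =>
  if pselect (i = j) is left ij then ecast l (hom (G l) Y) ij h else 0).
have <- : m ∘ inj i = h.
  by rewrite mE; case: pselect => // ii; rewrite (Prop_irrelevance ii erefl).
by rewrite !compA e.
Qed.

(** * Colimits from coproducts and cokernels *)

Section Cokernels.
Hypothesis hcoprod : has_coproducts S.
Hypothesis hcoker :
  forall (X Y : S) (f : hom X Y), exists (Q : S) (p : hom Y Q), is_cokernel f p.

(* The colimit is the cokernel of the difference of the two maps
   \coprod_(u : i -> j) D i -> \coprod_j D j. *)
Lemma colimit_exists (J : smallcat) (D : diagram S J) :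
  exists c : cocone D, is_colimit c.
Proof.
have [X [inj uX]] := hcoprod (dob D).
pose arr := {p : J * J & shom p.1 p.2}.
have [Y [injY uY]] := hcoprod (fun a : arr => dob D (projT1 a).1).
have [d [dE _]] := uY X (fun a =>
  inj (projT1 a).2 ∘ dmap D (projT2 a) - inj (projT1 a).1).
have [Q [p /cokernelP[ep pd uQ]]] := hcoker d.
have pE i j (u : shom i j) : p ∘ inj j ∘ dmap D u = p ∘ inj i.
  apply/eqP; rewrite -subr_eq0 -compA -compBr.
  by rewrite -(dE (existT _ (i, j) u)) compA pd comp0l.
exists (Cocone pE) => c'.
have [h [hE uh]] := uX _ (leg c').
have [h' h'E] : exists h', h' ∘ p = h.
  apply: uQ; apply: (coproduct_ext uY) => -[[i j] u].
  by rewrite comp0l -compA dE /= compBr compA !hE legE subrr.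
exists h'; split=> [j|h'' h''E] /=; first by rewrite compA h'E hE.
by apply: ep; rewrite h'E; apply: uh => j; rewrite -compA h''E.
Qed.

End Cokernels.

(** * Images in an abelian category *)

Section Abelian.
Hypothesis abS : abelian S.

(** The mono f is a kernel of some h, and h factors through p because it kills f; so whatever p
    kills is killed by h. *)
Lemma mono_kernel_cokernel (X Y Q : S) (f : hom X Y) (p : hom Y Q) :
  is_mono f -> is_cokernel f p -> is_kernel f p.
Proof.
move=> mf /cokernelP[_ pf up]; apply/kernelP; split=> // Z g pg.
have [_ _ _ /(_ _ _ f mf) [W [h /kernelP[_ hf uh]]] _] := abS.
have [h' h'E] := up _ _ hf; apply: uh.
by rewrite -h'E -compA pg comp0r.
Qed.

Lemma epi_cokernel_kernel (X Y K : S) (f : hom X Y) (i : hom K X) :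
  is_epi f -> is_kernel i f -> is_cokernel i f.
Proof.
move=> ef /kernelP[_ fi ui]; apply/cokernelP; split=> // Z g gi.
have [_ _ _ _ /(_ _ _ f ef) [W [h /cokernelP[_ fh uh]]]] := abS.
have [h' h'E] := ui _ _ fh; apply: uh.
by rewrite -h'E compA gi comp0l.
Qed.

Lemma image_factorization (X Y : S) (f : hom X Y) :
  exists (I : S) (e : hom X I) (i : hom I Y), [/\ is_epi e, is_mono i & i ∘ e = f].
Proof.
have [_ hker hcoker _ _] := abS.
have [Q [q /cokernelP[eq qf uq]]] := hcoker _ _ f.
have [I [i /kernelP[mi qi ui]]] := hker _ _ q.
have [e ie] := ui _ _ qf; exists I, e, i; split=> //.
(* If g kills e, then f factors through i restricted to J = ker g. The cokernel p of [i ∘ j] then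
   factors through q, so p kills i, and i factors through [i ∘ j]. Hence j has a right inverse and g
   = 0. *)
apply/epiP => Z g ge.
have [J [j /kernelP[mj gj uj]]] := hker _ _ g.
have [e' e'E] := uj _ _ ge.
have [P [p pcoker]] := hcoker _ _ (i ∘ j).
have /kernelP[_ _ uij] := mono_kernel_cokernel (mono_comp mi mj) pcoker.
have /cokernelP[_ pij _] := pcoker.
have [p' p'E] : exists p', p' ∘ q = p.
  by apply: uq; rewrite -ie -e'E !compA -(compA p) pij comp0l.
have [t tE] : exists t, i ∘ j ∘ t = i.
  by apply: uij; rewrite -p'E -compA qi comp0r.
have jt : j ∘ t = idm I by apply: mi; rewrite comp_idr compA.
by rewrite -[LHS]comp_idr -jt compA gj comp0l.
Qed.

End Abelian.

(** * Coslices of a filtered category *)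

Section Coslice.
Variables (J : smallcat) (i : J).

Let cob : small := {j : J & shom i j}.
Let chom (a b : cob) : small :=
  {w : shom (projT1 a) (projT1 b) | scomp w (projT2 a) = projT2 b}.

Let chom_eq (a b : cob) (u v : chom a b) : sval u = sval v -> u = v.
Proof. by case: u v => [u uE] [v vE] /= e; exact: eq_exist. Qed.

Let ccomp (a b c : cob) (u : chom b c) (v : chom a b) : chom a c.
Proof. by exists (scomp (sval u) (sval v)); rewrite -scompA (svalP v) (svalP u). Defined.

Definition coslice : smallcat.
Proof.
refine (@Smallcat cob chom (fun a => exist _ (sidm _) (scomp_idl _)) ccomp _ _ _).
- by move=> a b u; apply: chom_eq; exact: scomp_idl.
- by move=> a b u; apply: chom_eq; exact: scomp_idr.
- by move=> a b c d u v w; apply: chom_eq; exact: scompA.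
Defined.

Lemma coslice_filtered : filtered J -> filtered coslice.
Proof.
move=> [_ hJ eJ]; split; first by exists; exists i; exact: sidm.
  move=> [j u] [j' u']; have [l [[a] [b]]] := hJ j j'.
  have [m [w wE]] := eJ _ _ (scomp a u) (scomp b u').
  exists (existT _ m (scomp w (scomp a u))); split; exists.
    by exists (scomp w a); rewrite /= scompA.
  by exists (scomp w b); rewrite /= wE scompA.
move=> [j u] [j' u'] [v vE] [v' v'E] /=; have [l [w wE]] := eJ _ _ v v'.
exists (existT _ l (scomp w u')).
by exists (exist (fun x : shom j' l => scomp x u' = scomp w u') w erefl); exact: chom_eq.
Qed.

Definition coslice_diagram (D : diagram S J) : diagram S coslice.
Proof.
refine (@Diagram k S coslice (fun a => D (projT1 a)) (fun a b w => dmap D (sval w)) _ _).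
- by move=> a; exact: dmap_id.
- by move=> a b c u v; exact: dmap_comp.
Defined.

Definition coslice_cocone (D : diagram S J) (c : cocone D) : cocone (coslice_diagram D).
Proof.
by refine (@Cocone k S coslice (coslice_diagram D) (apex c)
  (fun a => leg c (projT1 a)) _) => a b u; exact: (legE c (sval u)).
Defined.

(** The projection from the coslice to J is final: a cocone over the coslice extends to [D j]
    through any l that receives arrows from both i and j. *)
Lemma coslice_colimit (D : diagram S J) (c : cocone D) :
  filtered J -> is_colimit c -> is_colimit (coslice_cocone c).
Proof.
move=> [_ hJ eJ] cc c'.
pose L l (a : shom i l) : hom (D l) (apex c') := leg c' (existT _ l a).
have LE l m (a : shom i l) (p : shom l m) : L m (scomp p a) ∘ dmap D p = L l a.
  exact: (@legE _ _ _ _ c' (existT _ l a) (existT _ m (scomp p a))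
    (exist (fun x => scomp x a = scomp p a) p erefl)).
(* Independence of the choice: pass to a common target of l and l', then equalize the two arrows
   from i, then the two from j. *)
have indep j l l' (a : shom i l) (b : shom j l) (a' : shom i l') (b' : shom j l') :
    L l a ∘ dmap D b = L l' a' ∘ dmap D b'.
  have [m [[p] [p']]] := hJ l l'.
  have [n [w wE]] := eJ _ _ (scomp p a) (scomp p' a').
  have [o [v vE]] := eJ _ _ (scomp w (scomp p b)) (scomp w (scomp p' b')).
  rewrite -(LE _ _ a (scomp v (scomp w p))) -(LE _ _ a' (scomp v (scomp w p'))).
  by rewrite -!compA -!dmap_comp -!scompA wE vE.
have [d dE] : exists d : forall j, hom (D j) (apex c'),
    forall j l (a : shom i l) (b : shom j l), d j = L l a ∘ dmap D b.
  apply: (@choice_dep _ _ (fun j d => forall l (a : shom i l) (b : shom j l),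
    d = L l a ∘ dmap D b)) => j.
  have [l [[a] [b]]] := hJ i j; exists (L l a ∘ dmap D b) => l' a' b'; exact: indep.
have dn j j' (u : shom j j') : d j' ∘ dmap D u = d j.
  have [l [[a] [b]]] := hJ i j'.
  by rewrite (dE _ _ a b) (dE _ _ a (scomp b u)) dmap_comp compA.
have [h [hE uh]] := cc (Cocone dn); exists h; split=> [[j u]|h' h'E] /=.
  by rewrite hE /= (dE _ _ u (sidm j)) dmap_id comp_idr.
apply: uh => j /=; have [l [[a] [b]]] := hJ i j.
by rewrite (dE _ _ a b) -(legE c b) compA (h'E (existT _ l a)).
Qed.

Definition const_diagram (X : S) : diagram S coslice.
Proof.
refine (@Diagram k S coslice (fun=> X) (fun _ _ _ => idm X) _ _) => //.
by move=> *; rewrite comp_idl.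
Defined.

Definition const_cocone (X : S) : cocone (const_diagram X).
Proof.
by refine (@Cocone k S coslice (const_diagram X) X (fun=> idm X) _) => *;
  rewrite comp_idl.
Defined.

(** The identity of i is an initial object of the coslice, so every leg of a cocone on a constant
    diagram equals the leg there. *)
Lemma const_colimit (X : S) : is_colimit (const_cocone X).
Proof.
move=> c'; exists (leg c' (existT _ i (sidm i))); split=> [[j u]|h' h'E] /=.
  pose a : coslice := existT _ i (sidm i); pose b : coslice := existT _ j u.
  pose w : @shom coslice a b := exist (fun x => scomp x (sidm i) = u) u (scomp_idr u).
  by have /= <- := legE c' w; rewrite comp_idr comp_idr.
by rewrite -h'E comp_idr.
Qed.

End Coslice.

(** * Monomorphisms and filtered colimits *)

Section FilteredColimits.
Hypothesis grS : grothendieck S.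

(** The exactness axiom speaks of short exact sequences, so the monos are completed by their
    cokernels, which form a diagram with a colimit of its own. *)
Lemma filtered_colimit_mono (J : smallcat) (D E : diagram S J)
    (s : forall j, hom (D j) (E j)) (cD : cocone D) (cE : cocone E)
    (f : hom (apex cD) (apex cE)) :
  filtered J -> natural s -> (forall j, is_mono (s j)) ->
  is_colimit cD -> is_colimit cE ->
  (forall j, f ∘ leg cD j = leg cE j ∘ s j) -> is_mono f.
Proof.
move=> fJ ns ms hD hE fE; have [abS hcoprod ex _] := grS.
have [_ _ hcoker _ _] := abS.
have [F0 [t tE]] : exists (F0 : J -> S) (t : forall j, hom (E j) (F0 j)),
    forall j, is_cokernel (s j) (t j).
  have [F0 F0E] := choice (fun j => hcoker _ _ (s j)).
  by have [t tE] := choice_dep F0E; exists F0, t.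
have te j : is_epi (t j) by have /cokernelP[] := tE j.
(* The transition maps induced on the cokernels; they are functorial because each [t j] is epi. *)
have [m mE] : exists m : forall a : {p : J * J & shom p.1 p.2},
    hom (F0 (projT1 a).1) (F0 (projT1 a).2),
    forall a, m a ∘ t _ = t _ ∘ dmap E (projT2 a).
  apply: (@choice_dep _ _ (fun (a : {p : J * J & shom p.1 p.2}) m =>
    m ∘ t _ = t _ ∘ dmap E (projT2 a))).
  move=> [[i j] u] /=; have /cokernelP[_ _] := tE i; apply.
  by rewrite -compA -ns compA; have /cokernelP[_ -> _] := tE j; rewrite comp0l.
pose dm i j (u : shom i j) : hom (F0 i) (F0 j) := m (existT _ (i, j) u).
have dmE i j (u : shom i j) : dm _ _ u ∘ t i = t j ∘ dmap E u.
  exact: (mE (existT _ (i, j) u)).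
have dm_id i : dm _ _ (sidm i) = idm (F0 i).
  by apply: te; rewrite dmE dmap_id comp_idl comp_idr.
have dm_comp i j l (u : shom j l) (v : shom i j) :
    dm _ _ (scomp u v) = dm _ _ u ∘ dm _ _ v.
  by apply: te; rewrite dmE dmap_comp -compA dmE !compA dmE.
pose F := Diagram dm_id dm_comp.
have [cF hF] := colimit_exists hcoprod hcoker F.
have gn i j (u : shom i j) : leg cF j ∘ t j ∘ dmap E u = leg cF i ∘ t i.
  by rewrite -compA -dmE compA (legE cF).
have [g [gE _]] := hE (Cocone gn).
suff [/kernelP[mf _ _] _] : short_exact f g by exact: mf.
apply: (ex J D E F s t cD cE cF) => // j.
by split; first exact: mono_kernel_cokernel.
Qed.

(* Over the coslice i/J, the leg at i is the colimit of the monos D i -> D j. *)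
Lemma filtered_colimit_leg_mono (J : smallcat) (D : diagram S J) (c : cocone D) :
  filtered J -> (forall i j (u : shom i j), is_mono (dmap D u)) ->
  is_colimit c -> forall i, is_mono (leg c i).
Proof.
move=> fJ mD cc i.
pose s (a : coslice i) : hom (const_diagram i (D i) a) (coslice_diagram i D a) :=
  dmap D (projT2 a).
apply: (@filtered_colimit_mono _ _ _ s (const_cocone i (D i)) (coslice_cocone i c)).
- exact: coslice_filtered.
- by move=> a b [w wE] /=; rewrite comp_idr -dmap_comp wE.
- by move=> a; exact: mD.
- exact: const_colimit.
- exact: coslice_colimit.
- by move=> a /=; rewrite comp_idr legE.
Qed.

End FilteredColimits.

End LinearCategory.

Section LinearFunction.
Variables (k : fieldType) (U V : lmodType k) (f : U -> V) (hf : linear f).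
(* The unused argument lets the linear structure below be keyed on a constant. *)
Definition linear_pack_fun (_ : linear f) := f.
HB.instance Definition _ := GRing.isLinear.Build k U V *:%R (linear_pack_fun hf) hf.
Definition linear_pack : {linear U -> V} := linear_pack_fun hf.
Lemma linear_packE u : linear_pack u = f u. Proof. by []. Qed.
End LinearFunction.

(** * Tensoring objects with vector spaces *)

Section Tensoring.
Variables (k : fieldType) (S : lincat k) (T : tensoring S).

Lemma otensl_unit (M N : S) (f : hom M N) (V : lmodType k) v :
  otensl T f V ∘ ounit T M V v = ounit T N V v ∘ f.
Proof. exact: ofactorE. Qed.

Lemma otensr_unit (M : S) (V W : lmodType k) (h : {linear V -> W}) v :
  otensr T M h ∘ ounit T M V v = ounit T M W (h v).
Proof. exact: ofactorE. Qed.

Lemma otensl_is_linear (M N : S) (V : lmodType k) :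
  linear (fun f : hom M N => otensl T f V).
Proof.
move=> a f g; apply: otens_ext => v.
by rewrite compDl compZl !otensl_unit compDr compZr.
Qed.
Lemma otensl0 (M N : S) (V : lmodType k) : otensl T (0 : hom M N) V = 0.
Proof. exact: (linear0 (linear_pack (@otensl_is_linear M N V))). Qed.

Lemma otensl_otensr (M N : S) (f : hom M N) (V W : lmodType k) (h : {linear V -> W}) :
  otensl T f W ∘ otensr T M h = otensr T N h ∘ otensl T f V.
Proof.
apply: otens_ext => v.
by rewrite -!compA otensr_unit !otensl_unit compA otensr_unit.
Qed.

Lemma otensr_comp (M : S) (U V W : lmodType k) (g : {linear V -> W})
    (f : {linear U -> V}) :
  otensr T M g ∘ otensr T M f = otensr T M (g \o f)%FUN.
Proof. by apply: otens_ext => v; rewrite -compA !otensr_unit. Qed.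

Lemma eq_otensr (M : S) (V W : lmodType k) (f g : {linear V -> W}) :
  f =1 g -> otensr T M f = otensr T M g.
Proof. by move=> e; apply: otens_ext => v; rewrite !otensr_unit e. Qed.

Lemma otensl_epi (X Y : S) (p : hom X Y) (V : lmodType k) :
  is_epi p -> is_epi (otensl T p V).
Proof.
move=> ep; apply/epiP => Z g gp; apply: otens_ext => v; apply: ep.
by rewrite -compA -otensl_unit compA gp !comp0l.
Qed.

Section Form.
Variables (V : lmodType k) (l : {linear V -> k^o}).

(** Contraction with the linear form l, that is M ⊗ l followed by M ⊗ k = M. *)
Definition oform (M : S) : hom (otens T M V) M := orunit T M ∘ otensr T M l.

Lemma oform_unit (M : S) v : oform M ∘ ounit T M V v = l v *: idm M.
Proof. by rewrite /oform -compA otensr_unit; exact: ofactorE. Qed.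

Lemma oform_natural (M N : S) (f : hom M N) : oform N ∘ otensl T f V = f ∘ oform M.
Proof.
apply: otens_ext => v; rewrite -[RHS]compA oform_unit -compA otensl_unit compA oform_unit.
by rewrite compZl compZr comp_idl comp_idr.
Qed.

End Form.

(** M ⊗ k^n is a biproduct of n copies of M, with injections [e i] and natural projections [p i];
    monicity is checked in each coordinate. *)
Lemma otensl_mono_free (M N : S) (f : hom M N) n :
  is_mono f -> is_mono (otensl T f 'rV[k]_n).
Proof.
move=> /monoP mf; apply/monoP => Z g fg.
have coord_lin (i : 'I_n) : linear (fun u : 'rV[k]_n => u 0 i : k^o).
  by move=> a u v; rewrite !mxE.
pose p i := oform (linear_pack (coord_lin i)) M.
pose e i : hom M (otens T M 'rV[k]_n) := ounit T M _ (delta_mx 0 i).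
have id_sum : \sum_i (e i ∘ p i) = idm (otens T M 'rV[k]_n).
  apply: otens_ext => v; rewrite comp_suml comp_idl [in RHS](row_sum_delta v) linear_sum.
  apply: eq_bigr => i _.
  by rewrite -compA /p oform_unit compZr comp_idr linearZ.
rewrite -[g]comp_idl -id_sum comp_suml big1 // => i _.
rewrite -compA (mf _ (p i ∘ g)) ?comp0r //.
by rewrite compA /p -oform_natural -compA fg comp0r.
Qed.

(** * A vector space as a filtered colimit of spaces k^n *)

Section VectorSpaceColimit.
Variable V : lmodType k.

Let fob : small := {n : nat & {linear 'rV[k]_n -> V}}.
Let fhom (a b : fob) : small :=
  {A : 'M[k]_(projT1 a, projT1 b) | forall u, projT2 b (u *m A) = projT2 a u}.

Let fhom_eq (a b : fob) (u v : fhom a b) : sval u = sval v -> u = v.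
Proof. by case: u v => [u uE] [v vE] /= e; exact: eq_exist. Qed.

Let fidm (a : fob) : fhom a a.
Proof. by exists 1%:M => u; rewrite mulmx1. Defined.

Let fcomp (a b c : fob) (A : fhom b c) (B : fhom a b) : fhom a c.
Proof. by exists (sval B *m sval A) => u; rewrite mulmxA (svalP A) (svalP B). Defined.

(* The category of elements of the functor n |-> V^n on free modules; V is its
   colimit. *)
Definition free_over : smallcat.
Proof.
refine (@Smallcat fob fhom fidm fcomp _ _ _).
- by move=> a b u; apply: fhom_eq; exact: mulmx1.
- by move=> a b u; apply: fhom_eq; exact: mul1mx.
- by move=> a b c d u v w; apply: fhom_eq; rewrite /= mulmxA.
Defined.

Lemma free_over_filtered : filtered free_over.
Proof.
split.
- by exists; exists 0%N; exact: \0%R.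
- move=> [n x] [m y].
  have z_lin : linear (fun u : 'rV[k]_(n + m) => x (lsubmx u) + y (rsubmx u)).
    by move=> a u v; rewrite !linearP scalerDr addrACA.
  exists (existT _ (n + m)%N (linear_pack z_lin)); split; exists.
    exists (row_mx 1%:M 0) => u /=.
    by rewrite linear_packE mul_mx_row row_mxKl row_mxKr mulmx1 mulmx0 linear0 addr0.
  exists (row_mx 0 1%:M) => u /=.
  by rewrite linear_packE mul_mx_row row_mxKl row_mxKr mulmx1 mulmx0 linear0 add0r.
- move=> [n x] [m y] [A AE] [B BE] /=.
  (* The endomorphism P of (m, y) coequalizes A and B: D P = 0 by the pseudo-inverse identity, and y
     is unchanged by P because it vanishes on the rows of D. *)
  pose D : 'M[k]_(n, m) := A - B; pose P := 1%:M - pinvmx D *m D.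
  have yD u : y (u *m D) = 0 by rewrite mulmxBr linearB AE BE subrr.
  have PE u : y (u *m P) = y u.
    by rewrite mulmxBr mulmx1 linearB mulmxA yD subr0.
  exists (existT _ m y).
  exists (exist (fun P : 'M[k]_m => forall u, y (u *m P) = y u) P PE).
  apply: fhom_eq => /=; apply/eqP; rewrite -subr_eq0 -mulmxBl -/D.
  by rewrite mulmxBr mulmx1 mulmxA mulmxKpV ?submx_refl // subrr.
Qed.

Section Diagram.
Variable M : S.

Definition free_diagram : diagram S free_over.
Proof.
refine (@Diagram k S free_over (fun a => otens T M 'rV[k]_(projT1 a))
  (fun a b A => otensr T M (mulmxr (sval A))) _ _).
- move=> a; apply: otens_ext => v.
  by rewrite otensr_unit /= mulmx1 comp_idl.
- move=> a b c u v; rewrite otensr_comp; apply: eq_otensr => w.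
  by rewrite /= mulmxA.
Defined.

Definition free_cocone : cocone free_diagram.
Proof.
refine (@Cocone k S free_over free_diagram (otens T M V)
  (fun a => otensr T M (projT2 a)) _) => a b A.
by rewrite otensr_comp; apply: eq_otensr => u; exact: (svalP A).
Defined.

(** A cocone is determined by its legs at rank one: a vector v is a map from k to V, and [phi v] is
    the value of that leg at 1. *)
Lemma free_colimit : is_colimit free_cocone.
Proof.
move=> c'.
pose L n (x : {linear 'rV[k]_n -> V}) : hom (otens T M 'rV[k]_n) (apex c') :=
  leg c' (existT _ n x).
have vect_lin (v : V) : linear (fun u : 'rV[k]_1 => u 0 0 *: v).
  by move=> a u w; rewrite !mxE scalerDl scalerA.
pose phi (v : V) := L 1%N (linear_pack (vect_lin v)) ∘ ounit T M _ 1%:M.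
(* The row u is itself an arrow from rank one to (n, x), so compatibility along it reduces any value
   to [phi]. *)
have LE n (x : {linear 'rV[k]_n -> V}) u : L n x ∘ ounit T M _ u = phi (x u).
  have uE (w : 'rV[k]_1) : x (w *m u) = linear_pack (vect_lin (x u)) w.
    by rewrite {1}(mx11_scalar w) mul_scalar_mx linearZ.
  pose A : @shom free_over (existT _ 1%N (linear_pack (vect_lin (x u)))) (existT _ n x) :=
    exist (fun A : 'M[k]_(1, n) =>
      forall w, x (w *m A) = linear_pack (vect_lin (x u)) w) u uE.
  by rewrite /phi /L -(legE c' A) -compA otensr_unit /= mul1mx.
have phi_lin : linear phi.
  move=> a v w.
  (* Both v and w are images of basis vectors under one map z from k^2, and the leg at z is linear
     in the row. *)
  have z_lin : linear (fun u : 'rV[k]_2 => u 0 0 *: v + u 0 1 *: w).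
    by move=> b u u'; rewrite !mxE !scalerDl !scalerDr !scalerA addrACA.
  pose z := linear_pack z_lin.
  have zv : z (delta_mx 0 0) = v.
    by rewrite linear_packE !mxE /= scale1r scale0r addr0.
  have zw : z (delta_mx 0 1) = w.
    by rewrite linear_packE !mxE /= scale1r scale0r add0r.
  by rewrite -{1}zv -{1}zw -linearP -LE linearP compDr compZr !LE zv zw.
exists (ofactor T (linear_pack phi_lin)); split=> [[n x]|h hE] /=.
  by apply: otens_ext => u; rewrite -compA otensr_unit ofactorE LE.
apply: otens_ext => v; rewrite ofactorE linear_packE /phi /L -hE /= -compA.
by rewrite otensr_unit linear_packE mxE scale1r.
Qed.

End Diagram.
End VectorSpaceColimit.

(** Passage to the filtered colimit over [free_over V] from the case of k^n. *)
Lemma otensl_mono (M N : S) (f : hom M N) (V : lmodType k) :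
  grothendieck S -> is_mono f -> is_mono (otensl T f V).
Proof.
move=> grS mf.
pose s (a : free_over V) : hom (free_diagram V M a) (free_diagram V N a) :=
  otensl T f 'rV[k]_(projT1 a).
apply: (@filtered_colimit_mono _ _ grS _ _ _ s (free_cocone V M) (free_cocone V N)).
- exact: free_over_filtered.
- by move=> a b A; rewrite /s /= otensl_otensr.
- by move=> a; exact: otensl_mono_free.
- exact: free_colimit.
- exact: free_colimit.
- by move=> a; rewrite /s /= otensl_otensr.
Qed.

(** Tensoring with V is a left adjoint: a map that kills f ⊗ V curries to one that kills f, hence
    factors through p. *)
Lemma otensl_cokernel (H : cotensoring T) (X Y Q : S) (f : hom X Y) (p : hom Y Q)
    (V : lmodType k) :
  is_cokernel f p -> is_cokernel (otensl T f V) (otensl T p V).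
Proof.
move=> /cokernelP[ep pf up]; apply/cokernelP; split.
- exact: otensl_epi.
- by rewrite -otensl_comp pf otensl0.
- move=> Z g gf.
  have [h hE] : exists h, h ∘ p = ocurry H g.
    apply: up; apply: ohom_ext.
    by rewrite otensl_comp compA ocurryE gf otensl0 comp0r.
  exists (oeval H V Z ∘ otensl T h V).
  by rewrite -compA -otensl_comp hE ocurryE.
Qed.

(** Write f as a mono j after an epi e. The short exact sequence of i and e stays exact after
    tensoring, and j ⊗ V is still mono, so e ⊗ V and f ⊗ V have the same kernel. *)
Lemma otensl_kernel (H : cotensoring T) (K X Y : S) (i : hom K X) (f : hom X Y)
    (V : lmodType k) :
  grothendieck S -> is_kernel i f -> is_kernel (otensl T i V) (otensl T f V).
Proof.
move=> grS /kernelP[mi fi ui]; have [abS _ _ _] := grS.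
have [I [e [j [ee mj je]]]] := image_factorization abS f.
have eE : is_cokernel i e.
  apply: epi_cokernel_kernel => //; apply/kernelP; split=> // [|Z g eg].
    by apply: mj; rewrite compA je fi comp0r.
  by apply: ui; rewrite -je -compA eg comp0r.
have /kernelP[miV eiV uiV] : is_kernel (otensl T i V) (otensl T e V).
  by apply: mono_kernel_cokernel => //; [exact: otensl_mono | exact: otensl_cokernel].
apply/kernelP; split=> // [|Z g].
  by rewrite -otensl_comp fi otensl0.
rewrite -je otensl_comp -compA => jeg; apply: uiV.
by apply: (otensl_mono grS mj); rewrite jeg comp0r.
Qed.

End Tensoring.

(** * Uniqueness of kernels, cokernels and colimits up to isomorphism *)

Section Uniqueness.
Variables (k : fieldType) (S : lincat k).

Lemma kernel_unique (K K' X Y : S) (i : hom K X) (i' : hom K' X) (f : hom X Y) :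
  is_kernel i f -> is_kernel i' f ->
  exists (u : hom K' K) (v : hom K K'), [/\ i ∘ u = i', u ∘ v = idm K & v ∘ u = idm K'].
Proof.
move=> /kernelP[mi fi ui] /kernelP[mi' fi' ui'].
have [u uE] := ui _ _ fi'; have [v vE] := ui' _ _ fi.
exists u, v; split=> //; first by apply: mi; rewrite compA uE vE comp_idr.
by apply: mi'; rewrite compA vE uE comp_idr.
Qed.

Lemma kernel_iso (K K' X Y : S) (i : hom K X) (f : hom X Y) (u : hom K' K)
    (v : hom K K') :
  is_kernel i f -> u ∘ v = idm K -> v ∘ u = idm K' -> is_kernel (i ∘ u) f.
Proof.
move=> /kernelP[mi fi ui] uv vu; apply/kernelP; split.
- apply: mono_comp => // Z g h e.
  by rewrite -[g]comp_idl -[h]comp_idl -vu -!compA e.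
- by rewrite compA fi comp0l.
- move=> Z g /ui[h hE]; exists (v ∘ h).
  by rewrite -compA (compA u) uv comp_idl.
Qed.

Lemma cokernel_unique (X Y Q Q' : S) (f : hom X Y) (p : hom Y Q) (p' : hom Y Q') :
  is_cokernel f p -> is_cokernel f p' ->
  exists (u : hom Q Q') (v : hom Q' Q), [/\ u ∘ p = p', u ∘ v = idm Q' & v ∘ u = idm Q].
Proof.
move=> /cokernelP[ep pf up] /cokernelP[ep' pf' up'].
have [u uE] := up _ _ pf'; have [v vE] := up' _ _ pf.
exists u, v; split=> //; first by apply: ep'; rewrite -compA vE uE comp_idl.
by apply: ep; rewrite -compA uE vE comp_idl.
Qed.

Lemma cokernel_iso (X Y Q Q' : S) (f : hom X Y) (p : hom Y Q) (u : hom Q Q')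
    (v : hom Q' Q) :
  is_cokernel f p -> u ∘ v = idm Q' -> v ∘ u = idm Q -> is_cokernel f (u ∘ p).
Proof.
move=> /cokernelP[ep pf up] uv vu; apply/cokernelP; split.
- move=> Z g h e; have e' : g ∘ u = h ∘ u by apply: ep; rewrite -!compA.
  by rewrite -[g]comp_idr -[h]comp_idr -uv !compA e'.
- by rewrite -compA pf comp0r.
- move=> Z g /up[h hE]; exists (h ∘ v).
  by rewrite -compA (compA v) vu comp_idl.
Qed.

Lemma colimit_unique (J : smallcat) (D : diagram S J) (c c' : cocone D) :
  is_colimit c -> is_colimit c' ->
  exists (u : hom (apex c) (apex c')) (v : hom (apex c') (apex c)),
    [/\ forall j, u ∘ leg c j = leg c' j, forall j, v ∘ leg c' j = leg c j,
        u ∘ v = idm (apex c') & v ∘ u = idm (apex c)].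
Proof.
move=> cc cc'; have [u [uE _]] := cc c'; have [v [vE _]] := cc' c.
exists u, v; split=> //; apply: colimit_ext => // j.
  by rewrite -compA vE uE comp_idl.
by rewrite -compA uE vE comp_idl.
Qed.

End Uniqueness.

(** * Comodules and the forgetful functor *)

Section ComoduleCategory.
Variables (k : fieldType) (S : lincat k) (T : tensoring S) (C : coalgebra k).

Lemma oassoc_unit (M : S) (V W : lmodType k) v w :
  oassoc T M V W ∘ (ounit T (otens T M V) W w ∘ ounit T M V v)
  = ounit T M (tprod V W) (tens v w).
Proof. by rewrite compA ofactorE; exact: ofactorE. Qed.

Lemma oassoc_natural (M N : S) (f : hom M N) (V W : lmodType k) :
  oassoc T N V W ∘ otensl T (otensl T f V) W = otensl T f (tprod V W) ∘ oassoc T M V W.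
Proof.
apply: otens_ext => w; apply: otens_ext => v.
rewrite -!compA oassoc_unit otensl_unit (compA (otensl T (otensl T f V) W)) otensl_unit.
by rewrite -compA otensl_unit (compA (ounit T (otens T N V) W w)) compA oassoc_unit.
Qed.

Definition is_coaction (X : S) (r : hom X (otens T X C)) : Prop :=
  oassoc T X C C ∘ otensl T r C ∘ r = otensr T X (comul C) ∘ r /\
  orunit T X ∘ otensr T X (counit C) ∘ r = idm X.

Section Transport.
Variables (X Y : S) (l : hom X Y) (rX : hom X (otens T X C)) (rY : hom Y (otens T Y C)).
Hypothesis lE : rY ∘ l = otensl T l C ∘ rX.

(** This and the next two lemmas compare the sides of the comodule axioms along l; the axioms thus
    pass forward along jointly epic families and backward along monos. *)
Lemma coactA_transport :
  oassoc T Y C C ∘ otensl T rY C ∘ rY ∘ l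
  = otensl T l (tprod C C) ∘ (oassoc T X C C ∘ otensl T rX C ∘ rX).
Proof.
rewrite -compA lE -compA (compA (otensl T rY C)) -otensl_comp lE otensl_comp.
by rewrite !compA oassoc_natural.
Qed.

Lemma comul_transport :
  otensr T Y (comul C) ∘ rY ∘ l
  = otensl T l (tprod C C) ∘ (otensr T X (comul C) ∘ rX).
Proof. by rewrite -compA lE !compA otensl_otensr. Qed.

Lemma counit_transport :
  orunit T Y ∘ otensr T Y (counit C) ∘ rY ∘ l
  = l ∘ (orunit T X ∘ otensr T X (counit C) ∘ rX).
Proof. by rewrite -compA lE compA -/(oform T (counit C) Y) oform_natural !compA. Qed.

End Transport.

Lemma coaction_epi_family (I : Type) (P : I -> comodule T C) (X : S)
    (l : forall i, hom (cmob (P i)) X) (r : hom X (otens T X C)) :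
  (forall Y (f g : hom X Y), (forall i, f ∘ l i = g ∘ l i) -> f = g) ->
  (forall i, r ∘ l i = otensl T (l i) C ∘ coact (P i)) ->
  is_coaction r.
Proof.
move=> el rl; split.
  by apply: el => i; rewrite (coactA_transport (rl i)) (comul_transport (rl i)) coactA.
by apply: el => i; rewrite (counit_transport (rl i)) coact1 comp_idl comp_idr.
Qed.

Lemma coaction_mono (P : comodule T C) (X : S) (l : hom X (cmob P))
    (r : hom X (otens T X C)) :
  grothendieck S -> is_mono l -> coact P ∘ l = otensl T l C ∘ r ->
  is_coaction r.
Proof.
move=> grS ml rl; split.
  have mlC : is_mono (otensl T l (tprod C C)) by exact: otensl_mono.
  by apply: mlC; rewrite -(coactA_transport rl) -(comul_transport rl) coactA.
by apply: ml; rewrite -(counit_transport rl) coact1 comp_idl comp_idr.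
Qed.


Local Notation SC := (comodule_cat T C).

Definition forget (P Q : SC) (f : hom P Q) : hom (cmob P) (cmob Q) := cmhom f.

Section Forget.
Variables P Q R : SC.

Lemma forget_inj : injective (@forget P Q). Proof. exact: val_inj. Qed.

Lemma forget0 : forget (0 : hom P Q) = 0. Proof. by []. Qed.

Lemma forget_colinear (f : hom P Q) :
  coact Q ∘ forget f = otensl T (forget f) C ∘ coact P.
Proof. exact: comodule_homP. Qed.

Lemma forget_lift (f : hom (cmob P) (cmob Q)) :
  coact Q ∘ f = otensl T f C ∘ coact P -> exists g : hom P Q, forget g = f.
Proof. by move=> /eqP h; exists (ComoduleHom h). Qed.

End Forget.

Lemma forget_mono (P Q : SC) (f : hom P Q) : is_mono (forget f) -> is_mono f.
Proof.
by move=> mf Z g h e; apply: forget_inj; apply: mf; exact: (congr1 (@forget _ _) e).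
Qed.

Lemma forget_epi (P Q : SC) (f : hom P Q) : is_epi (forget f) -> is_epi f.
Proof.
by move=> ef Z g h e; apply: forget_inj; apply: ef; exact: (congr1 (@forget _ _) e).
Qed.

Lemma epi_colinear (P Q R : SC) (p : hom P Q) (g : hom P R) (h : hom (cmob Q) (cmob R)) :
  is_epi (forget p) -> h ∘ forget p = forget g -> exists h' : hom Q R, forget h' = h.
Proof.
move=> ep hp; apply: forget_lift; apply: ep.
by rewrite -!compA forget_colinear hp forget_colinear -hp otensl_comp compA.
Qed.

Lemma mono_colinear (P Q R : SC) (i : hom P Q) (g : hom R Q) (h : hom (cmob R) (cmob P)) :
  grothendieck S -> is_mono (forget i) -> forget i ∘ h = forget g ->
  exists h' : hom R P, forget h' = h.
Proof.
move=> grS mi ih; apply: forget_lift; apply: (otensl_mono grS mi).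
by rewrite !compA -forget_colinear -compA ih forget_colinear -ih otensl_comp.
Qed.

Lemma forget_cokernel_reflect (P Q R : SC) (f : hom P Q) (p : hom Q R) :
  is_cokernel (forget f) (forget p) -> is_cokernel f p.
Proof.
move=> /cokernelP[ep pf up]; apply/cokernelP; split.
- exact: forget_epi.
- exact: forget_inj.
- move=> Z g gf; have [h hp] := up _ (forget g) (congr1 (@forget _ _) gf).
  have [h' h'E] := epi_colinear ep hp.
  by exists h'; apply: forget_inj; rewrite -hp -h'E.
Qed.

Lemma forget_kernel_reflect (P Q R : SC) (i : hom P Q) (f : hom Q R) :
  grothendieck S -> is_kernel (forget i) (forget f) -> is_kernel i f.
Proof.
move=> grS /kernelP[mi fi ui]; apply/kernelP; split.
- exact: forget_mono.
- exact: forget_inj.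
- move=> Z g fg; have [h ih] := ui _ (forget g) (congr1 (@forget _ _) fg).
  have [h' h'E] := mono_colinear grS mi ih.
  by exists h'; apply: forget_inj; rewrite -ih -h'E.
Qed.

(** * Colimits of comodules *)

Section Diagrams.
Variables (J : smallcat) (D : diagram SC J).

Definition forget_diagram : diagram S J :=
  @Diagram k S J (fun j => cmob (D j)) (fun i j u => forget (dmap D u))
    (fun i => congr1 (@forget _ _) (dmap_id D i))
    (fun i j l u v => congr1 (@forget _ _) (dmap_comp D u v)).

Definition forget_cocone (c : cocone D) : cocone forget_diagram :=
  @Cocone k S J forget_diagram (cmob (apex c)) (fun j => forget (leg c j))
    (fun i j u => congr1 (@forget _ _) (legE c u)).

Lemma forget_colimit_reflect (c : cocone D) :
  is_colimit (forget_cocone c) -> is_colimit c.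
Proof.
move=> cc c'; have [h [hE uh]] := cc (forget_cocone c').
have [h' h'E] : exists h' : hom (apex c) (apex c'), forget h' = h.
  apply: forget_lift; apply: (colimit_ext cc) => j.
  by rewrite -!compA forget_colinear hE forget_colinear compA -otensl_comp hE.
exists h'; split=> [j|g gE].
  by apply: forget_inj; have := hE j; rewrite -h'E.
by apply: forget_inj; rewrite h'E; apply: uh => j; rewrite /= -gE.
Qed.

(** The coactions of the terms induce one on the colimit; its axioms hold because the legs are
    jointly epic. *)
Lemma forget_colimit_lift (c : cocone forget_diagram) :
  is_colimit c -> exists c' : cocone D, is_colimit (forget_cocone c').
Proof.
move=> cc.
pose l j := otensl T (leg c j) C ∘ coact (D j).
have lE i j (u : shom i j) : l j ∘ dmap forget_diagram u = l i.
  rewrite /l -compA forget_colinear compA -otensl_comp.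
  by rewrite (legE c).
have [r [rE _]] := cc (Cocone lE).
have [rA r1] : is_coaction r.
  by apply: (@coaction_epi_family J (dob D) _ (leg c)) => // Y f g; exact: (colimit_ext cc).
pose Q : SC := Comodule rA r1.
have [l' l'E] : exists l' : forall j, hom (D j) Q, forall j, forget (l' j) = leg c j.
  apply: (@choice_dep _ _ (fun j (l' : hom (D j) Q) => forget l' = leg c j)) => j.
  by apply: forget_lift; exact: rE.
have l'n i j (u : shom i j) : l' j ∘ dmap D u = l' i.
  by apply: forget_inj; rewrite l'E -(legE c u) -l'E.
exists (Cocone l'n) => c'; have [h [hE uh]] := cc c'; exists h.
by split=> [j|g gE] /=; [rewrite l'E hE | apply: uh => j; rewrite -l'E; exact: gE].
Qed.

(** The cocone c is isomorphic, as comodules, to a colimit lifted from S, and the universal property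
    moves along this isomorphism. *)
Lemma forget_colimit (c : cocone D) :
  grothendieck S -> is_colimit c -> is_colimit (forget_cocone c).
Proof.
move=> [[_ _ hcoker _ _] hcoprod _ _] cc.
have [c0 cc0] := colimit_exists hcoprod hcoker forget_diagram.
have [c1 cc1] := forget_colimit_lift cc0.
have [u [v [uE vE _ vu]]] := colimit_unique cc (forget_colimit_reflect cc1).
have vu' : forget v ∘ forget u = idm _ := congr1 (@forget _ _) vu.
have uE' j : forget u ∘ forget (leg c j) = forget (leg c1 j).
  exact: (congr1 (@forget _ _) (uE j)).
have vE' j : forget v ∘ forget (leg c1 j) = forget (leg c j).
  exact: (congr1 (@forget _ _) (vE j)).
move=> c'; have [h [hE uh]] := cc1 c'; exists (h ∘ forget u); split=> [j|g gE] /=.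
  by rewrite -compA uE'; exact: hE.
rewrite (uh (g ∘ forget v)) -?compA ?vu' ?comp_idr // => j.
by rewrite -compA /= vE'; exact: gE.
Qed.

End Diagrams.

(** * The Grothendieck axioms for comodules *)

Hypothesis grS : grothendieck S.
Variable H : cotensoring T.

Lemma comodule_cokernel (P Q : SC) (f : hom P Q) :
  exists (R : SC) (p : hom Q R), is_cokernel (forget f) (forget p).
Proof.
have [[_ _ hcoker _ _] _ _ _] := grS.
have [X [p pE]] := hcoker _ _ (forget f); have /cokernelP[ep pf up] := pE.
have [r rE] : exists r, r ∘ p = otensl T p C ∘ coact Q.
  by apply: up; rewrite -compA forget_colinear compA -otensl_comp pf otensl0 comp0l.
have [rA r1] : is_coaction r.
  by apply: (@coaction_epi_family unit (fun=> Q) _ (fun=> p)) => // Y g h /(_ tt); exact: ep.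
pose R : SC := Comodule rA r1.
have [p' p'E] := @forget_lift Q R p rE.
by exists R, p'; rewrite p'E.
Qed.

Lemma comodule_kernel (P Q : SC) (f : hom P Q) :
  exists (R : SC) (i : hom R P), is_kernel (forget i) (forget f).
Proof.
have [[_ hker _ _ _] _ _ _] := grS.
have [X [i iE]] := hker _ _ (forget f); have /kernelP[mi fi _] := iE.
have /kernelP[_ _ ui] := otensl_kernel H C grS iE.
(* By left exactness X ⊗ C is the kernel of f ⊗ C, and colinearity of f sends [coact P ∘ i] into
   it. *)
have [r rE] : exists r, otensl T i C ∘ r = coact P ∘ i.
  by apply: ui; rewrite compA -forget_colinear -compA fi comp0r.
have [rA r1] : is_coaction r by apply: (@coaction_mono P _ i).
pose R : SC := Comodule rA r1.
have [i' i'E] := @forget_lift R P i (esym rE).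
by exists R, i'; rewrite i'E.
Qed.

Lemma forget_cokernel (P Q R : SC) (f : hom P Q) (p : hom Q R) :
  is_cokernel f p -> is_cokernel (forget f) (forget p).
Proof.
move=> pE; have [R' [p' p'E]] := comodule_cokernel f.
have [u [v [<- uv vu]]] := cokernel_unique (forget_cokernel_reflect p'E) pE.
apply: (@cokernel_iso _ _ _ _ _ _ _ _ (forget u) (forget v) p'E).
  exact: (congr1 (@forget _ _) uv).
exact: (congr1 (@forget _ _) vu).
Qed.

Lemma forget_kernel (P Q R : SC) (i : hom P Q) (f : hom Q R) :
  is_kernel i f -> is_kernel (forget i) (forget f).
Proof.
move=> iE; have [R' [i' i'E]] := comodule_kernel f.
have [u [v [<- uv vu]]] := kernel_unique (forget_kernel_reflect grS i'E) iE.
apply: (@kernel_iso _ _ _ _ _ _ _ _ (forget u) (forget v) i'E).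
  exact: (congr1 (@forget _ _) uv).
exact: (congr1 (@forget _ _) vu).
Qed.

(** The kernel of f in S carries a coaction, so a colinear mono already has zero kernel in S. *)
Lemma mono_forget (P Q : SC) (f : hom P Q) : is_mono f -> is_mono (forget f).
Proof.
move=> /monoP mf; have [K [i iE]] := comodule_kernel f.
have /kernelP[_ fi ui] := iE.
have i0 : i = 0 by apply: mf; exact: forget_inj.
by apply/monoP => Z g /ui[h <-]; rewrite i0 forget0 comp0l.
Qed.

Lemma epi_forget (P Q : SC) (f : hom P Q) : is_epi f -> is_epi (forget f).
Proof.
move=> /epiP ef; have [R [p pE]] := comodule_cokernel f.
have /cokernelP[_ pf up] := pE.
have p0 : p = 0 by apply: ef; exact: forget_inj.
by apply/epiP => Z g /up[h <-]; rewrite p0 forget0 comp0r.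
Qed.

Lemma comodule_coproducts : has_coproducts SC.
Proof.
move=> I F; have [_ hcoprod _ _] := grS.
have [X [inj u]] := hcoprod I (fun i => cmob (F i)).
have [r [rE _]] := u _ (fun i => otensl T (inj i) C ∘ coact (F i)).
have [rA r1] : is_coaction r.
  by apply: (@coaction_epi_family I F _ inj) => // Y f g; exact: (coproduct_ext u).
pose Q : SC := Comodule rA r1.
have [l lE] : exists l : forall i, hom (F i) Q, forall i, forget (l i) = inj i.
  apply: (@choice_dep _ _ (fun i (l : hom (F i) Q) => forget l = inj i)) => i.
  by apply: forget_lift; exact: rE.
exists Q, l => Y g; have [h [hE uh]] := u _ (fun i => forget (g i)).
have [h' h'E] : exists h' : hom Q Y, forget h' = h.
  apply: forget_lift; apply: (coproduct_ext u) => i.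
  by rewrite -!compA rE hE forget_colinear compA -otensl_comp hE.
exists h'; split=> [i|g' g'E].
  by apply: forget_inj; rewrite -hE -h'E -lE.
by apply: forget_inj; rewrite h'E; apply: uh => i; rewrite -g'E -lE.
Qed.

Lemma comodule_abelian : abelian SC.
Proof.
have [abS hcoprod _ _] := grS; have [[[O [O1 O2]] _] _ _ _ _] := abS.
split.
- split; last exact: coproducts_binary_products comodule_coproducts.
  have [rA r1] : is_coaction (0 : hom O (otens T O C)) by split; exact: O2.
  exists (Comodule rA r1); split=> X f g; apply: forget_inj; [exact: O1 | exact: O2].
- move=> X Y f; have [K [i iE]] := comodule_kernel f.
  by exists K, i; exact: forget_kernel_reflect.
- move=> X Y f; have [Q [p pE]] := comodule_cokernel f.
  by exists Q, p; exact: forget_cokernel_reflect.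
- move=> X Y f mf; have [Q [p pE]] := comodule_cokernel f.
  exists Q, p; apply: forget_kernel_reflect => //.
  by apply: mono_kernel_cokernel => //; exact: mono_forget.
- move=> X Y f ef; have [K [i iE]] := comodule_kernel f.
  exists K, i; apply: forget_cokernel_reflect.
  by apply: epi_cokernel_kernel => //; exact: epi_forget.
Qed.

Lemma comodule_filtered_colimits_exact : filtered_colimits_exact SC.
Proof.
move=> J D E F s t cD cE cF f g fJ ns nt st hD hE hF fE gE.
have [_ _ ex _] := grS.
have [fK gC] : short_exact (forget f) (forget g).
  apply: (ex J (forget_diagram D) (forget_diagram E) (forget_diagram F)
    (fun j => forget (s j)) (fun j => forget (t j))
    (forget_cocone cD) (forget_cocone cE) (forget_cocone cF)) => //.
  - by move=> i j u; exact: (congr1 (@forget _ _) (ns i j u)).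
  - by move=> i j u; exact: (congr1 (@forget _ _) (nt i j u)).
  - by move=> j; have [sK tC] := st j; split; [exact: forget_kernel | exact: forget_cokernel].
  - exact: forget_colimit.
  - exact: forget_colimit.
  - exact: forget_colimit.
  - by move=> j; exact: (congr1 (@forget _ _) (fE j)).
  - by move=> j; exact: (congr1 (@forget _ _) (gE j)).
by split; [exact: forget_kernel_reflect | exact: forget_cokernel_reflect].
Qed.

Lemma comodule_grothendieck (I : small) (G : I -> SC) :
  generating G -> grothendieck SC.
Proof.
move=> gG; split.
- exact: comodule_abelian.
- exact: comodule_coproducts.
- exact: comodule_filtered_colimits_exact.
- exact: coproduct_generator comodule_coproducts gG.
Qed.

End ComoduleCategory.

(** * Submodules cut out by a predicate *)

Section SubLmodule.
Variables (k : fieldType) (V : lmodType k) (P : V -> Prop).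
Hypotheses (P0 : P 0) (PL : forall a u v, P u -> P v -> P (a *: u + v)).

Definition sub_pred (_ : P 0) (_ : forall a u v, P u -> P v -> P (a *: u + v)) : pred V :=
  fun v => `[< P v >].

Fact sub_pred_closed : submod_closed (sub_pred P0 PL).
Proof.
split=> [|a u v]; rewrite !unfold_in; first exact/asboolP.
by move=> /asboolP Pu /asboolP Pv; apply/asboolP; exact: PL.
Qed.
HB.instance Definition _ := GRing.isSubmodClosed.Build k V (sub_pred P0 PL) sub_pred_closed.

Record sub_lmod := SubLmod { sub_val :> V; _ : sub_pred P0 PL sub_val }.
HB.instance Definition _ := [isSub for sub_val].
HB.instance Definition _ := [Choice of sub_lmod by <:].
HB.instance Definition _ := [SubChoice_isSubLmodule of sub_lmod by <:].

Lemma sub_lmod_exists :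
  exists (W : lmodType k) (i : {linear W -> V}),
    injective i /\ forall v, P v <-> exists w, i w = v.
Proof.
exists (sub_lmod : lmodType k), (val : {linear sub_lmod -> V}); split; first exact: val_inj.
move=> v; split=> [Pv|[[w Pw] <-]]; last exact/asboolP.
by have /asboolP Pv' := Pv; exists (SubLmod Pv').
Qed.

End SubLmodule.

(** * Finite generation as factorization through a term *)

Section FinitelyGenerated.
Variables (k : fieldType) (S : lincat k).

Section Colimit.
Variables (X : S) (J : smallcat) (D : diagram S J) (c : cocone D).
Hypotheses (fJ : filtered J) (cc : is_colimit c).
Hypothesis mD : forall i j (u : shom i j), is_mono (dmap D u).

(** The maps that factor through some term form a submodule W of Hom(X, colim D). The universal
    property gives [psi] into W; followed by the inclusion it agrees with the identity on all legs,
    hence everywhere, so W is the whole space. *)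
Lemma finitely_generated_factor :
  finitely_generated X ->
  forall f : hom X (apex c), exists j (g : hom X (D j)), leg c j ∘ g = f.
Proof.
move=> fgX.
pose P (f : hom X (apex c)) := exists j (g : hom X (D j)), leg c j ∘ g = f.
have [[j0] hJ eJ] := fJ.
have P0 : P 0 by exists j0, 0; rewrite comp0r.
have PL a u v : P u -> P v -> P (a *: u + v).
  move=> [i [f <-]] [j [g <-]]; have [l [[p] [q]]] := hJ i j.
  exists l, (a *: (dmap D p ∘ f) + dmap D q ∘ g).
  by rewrite compDr compZr !compA !legE.
have [W [iW [iW_inj PW]]] := sub_lmod_exists P0 PL.
have [phi phiE] : exists phi : forall j, hom X (D j) -> W,
    forall j g, iW (phi j g) = leg c j ∘ g.
  apply: (@choice_dep _ _ (fun j (phi : hom X (D j) -> W) =>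
    forall g, iW (phi g) = leg c j ∘ g)) => j.
  by apply: (@choice_dep _ _ (fun g w => iW w = leg c j ∘ g)) => g; apply/PW; exists j, g.
have phi_lin j : linear (phi j).
  by move=> a f g; apply: iW_inj; rewrite linearP !phiE compDr compZr.
have phi_dmap i j (u : shom i j) f :
    linear_pack (phi_lin j) (dmap D u ∘ f) = linear_pack (phi_lin i) f.
  by apply: iW_inj; rewrite !linear_packE !phiE compA legE.
have [psi [psiE _]] :=
  fgX J D c fJ mD cc W (fun j => linear_pack (phi_lin j)) phi_dmap.
have leg_dmap i j (u : shom i j) (f : hom X (D i)) :
    (postcomp (leg c j) : {linear _ -> _}) (dmap D u ∘ f) = postcomp (leg c i) f.
  by rewrite /= /postcomp compA legE.
have [theta [_ uth]] := fgX J D c fJ mD cc _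
  (fun j => postcomp (leg c j) : {linear _ -> _}) leg_dmap.
move=> f; apply/PW; exists (psi f).
have e1 : (iW \o psi)%FUN f = theta f.
  by apply: (uth (iW \o psi : {linear _ -> _})%FUN) => j g; rewrite /= psiE linear_packE phiE.
by rewrite [LHS]e1; symmetry; apply: (uth (idfun : {linear _ -> _})).
Qed.

Hypothesis leg_mono : forall j, is_mono (leg c j).
Hypothesis leg_factor :
  forall f : hom X (apex c), exists j (g : hom X (D j)), leg c j ∘ g = f.

(** A converse: [psi] is computed on any lift to a term. Two lifts agree at a common later index
    because the legs are monic. *)
Lemma factor_universal (W : lmodType k) (phi : forall j, {linear hom X (D j) -> W}) :
  (forall i j (u : shom i j) (f : hom X (D i)), phi j (dmap D u ∘ f) = phi i f) ->
  exists psi : {linear hom X (apex c) -> W},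
    (forall j f, psi (leg c j ∘ f) = phi j f) /\
    forall psi' : {linear hom X (apex c) -> W},
      (forall j f, psi' (leg c j ∘ f) = phi j f) -> psi' =1 psi.
Proof.
move=> phiE; have [_ hJ _] := fJ.
have [psi psiE] : exists psi : hom X (apex c) -> W,
    forall f j (g : hom X (D j)), leg c j ∘ g = f -> psi f = phi j g.
  apply: (@choice_dep _ _ (fun f w =>
    forall j (g : hom X (D j)), leg c j ∘ g = f -> w = phi j g)).
  move=> f; have [i [g gE]] := leg_factor f; exists (phi i g) => j g' g'E.
  have [l [[p] [q]]] := hJ i j; rewrite -(phiE _ _ p) -(phiE _ _ q).
  by congr (phi l _); apply: leg_mono; rewrite !compA !legE gE g'E.
have psi_lin : linear psi.
  move=> a u v; have [i [f fE]] := leg_factor u; have [j [g gE]] := leg_factor v.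
  have [l [[p] [q]]] := hJ i j.
  rewrite (psiE _ _ _ fE) (psiE _ _ _ gE) -(phiE _ _ p) -(phiE _ _ q) -linearP.
  by apply: psiE; rewrite compDr compZr !compA !legE fE gE.
exists (linear_pack psi_lin); split=> [j f|psi' psi'E f]; first exact: psiE.
by have [j [g gE]] := leg_factor f; rewrite linear_packE (psiE _ _ _ gE) -gE psi'E.
Qed.

End Colimit.
End FinitelyGenerated.

(** * Rational pairings and the action of A on comodules *)

Section Rational.
Variables (k : fieldType) (S : lincat k) (T : tensoring S) (H : cotensoring T).
Variables (C : coalgebra k) (A : algebra k) (beta : {linear tprod C A -> k^o}).
Hypotheses (grS : grothendieck S) (pairing_beta : is_pairing beta).
Hypothesis rational_beta : is_rational H beta.

Local Notation SC := (comodule_cat T C).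

Definition pform (a : A) (M : S) : hom (otens T M C) M := oform T (pairing_dual beta a) M.

Lemma pform_unit a M c : pform a M ∘ ounit T M C c = beta (tens c a) *: idm M.
Proof. exact: oform_unit. Qed.

Lemma pform_is_linear M : linear (fun a => pform a M).
Proof.
move=> z a b; apply: otens_ext => c.
rewrite compDl (compZl z (pform a M)) !pform_unit linearPr linearP.
by rewrite scalerDl scalerA.
Qed.

Lemma pform_natural a (M N : S) (f : hom M N) : pform a N ∘ otensl T f C = f ∘ pform a M.
Proof. exact: oform_natural. Qed.

(* Through the adjunctions, the morphism M ⊗ C -> Hom(A, M) is the family of the
   morphisms M ⊗ beta(-, a). *)
Lemma pform_jointly_monic (M Z : S) (g h : hom Z (otens T M C)) :
  (forall a, pform a M ∘ g = pform a M ∘ h) -> g = h.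
Proof.
move=> e; apply: (rational_beta (M := M)); apply: ohom_ext; apply: otens_ext => a.
have pairingE (f : hom Z (otens T M C)) :
    oeval H A M ∘ otensl T (pairing_mor H beta M ∘ f) A ∘ ounit T Z A a = pform a M ∘ f.
  rewrite otensl_comp compA ocurryE -compA otensl_unit compA; congr (_ ∘ f).
  apply: otens_ext => c; rewrite pform_unit -compA -compA oassoc_unit.
  exact: oform_unit.
by rewrite !pairingE.
Qed.

Definition act (P : SC) (a : A) : hom (cmob P) (cmob P) := pform a (cmob P) ∘ coact P.

Lemma act_natural (P Q : SC) (f : hom P Q) a : act Q a ∘ forget f = forget f ∘ act P a.
Proof. by rewrite /act -compA forget_colinear compA pform_natural compA. Qed.

Lemma act1 (P : SC) : act P (aone A) = idm (cmob P).
Proof.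
rewrite -(coact1 P) /act; congr (_ ∘ _); apply: otens_ext => c.
by rewrite pform_unit (pairing_beta.1 c : beta _ = _); exact/esym/oform_unit.
Qed.

(** By [E2] the form beta(-, ab) is beta(-, a) ⊗ beta(-, b) after comultiplication; coassociativity
    turns this into two successive coactions, which [E1] contracts one at a time. *)
Lemma actM (P : SC) a b : act P (amul A a b) = act P a ∘ act P b.
Proof.
set M := cmob P.
have conv_lin : linear (fun x : tprod C C =>
    tfactor (@kmul k) (tmap (pairing_dual beta a) (pairing_dual beta b) x) : k^o).
  by move=> z x y; rewrite !linearP.
have E1 : pform a M ∘ pform b (otens T M C) = oform T (linear_pack conv_lin) M ∘ oassoc T M C C.
  apply: otens_ext => c2; apply: otens_ext => c1.
  set F := oform _ _ _; rewrite -2!(compA F) -(compA (oassoc _ _ _ _)) oassoc_unit.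
  have convE : linear_pack conv_lin (tens c1 c2) = beta (tens c1 a) * beta (tens c2 b).
    by rewrite linear_packE /= !tfactorE.
  rewrite oform_unit convE -(compA (pform a M)) pform_unit.
  by rewrite compZr comp_idr compZl pform_unit scalerA mulrC.
have E2 : pform (amul A a b) M = oform T (linear_pack conv_lin) M ∘ otensr T M (comul C).
  apply: otens_ext => c; rewrite pform_unit -compA otensr_unit oform_unit.
  by rewrite (pairing_beta.2 a b c : beta _ = _).
rewrite /act E2 -[LHS]compA -coactA -[in LHS](compA (oassoc _ _ _ _)) [LHS]compA -E1.
rewrite -[LHS]compA -[RHS]compA; congr (_ ∘ _).
by rewrite [LHS]compA pform_natural -compA.
Qed.

Lemma act_colinear (P Q : SC) (f : hom (cmob P) (cmob Q)) :
  (forall a, act Q a ∘ f = f ∘ act P a) -> exists g : hom P Q, forget g = f.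
Proof.
move=> fE; apply: forget_lift; apply: pform_jointly_monic => a.
by rewrite [LHS]compA fE compA pform_natural -compA.
Qed.

(** * Orbit maps from G ⊗ A and the comodules they generate *)

Section Orbit.
Variables (G : S) (P : SC) (h : hom G (cmob P)).

Lemma orbit_is_linear : linear (fun a => act P a ∘ h).
Proof.
move=> z a b; rewrite /act pform_is_linear compDl (compZl z (pform a _)).
by rewrite compDl (compZl z (pform a _ ∘ _)).
Qed.

(** The A-linear extension of h, informally g ⊗ a ↦ a·h(g). *)
Definition orbit : hom (otens T G A) (cmob P) := ofactor T (linear_pack orbit_is_linear).

Lemma orbit_unit a : orbit ∘ ounit T G A a = act P a ∘ h.
Proof. exact: ofactorE. Qed.

Lemma orbit1 : orbit ∘ ounit T G A (aone A) = h.
Proof. by rewrite orbit_unit act1 comp_idl. Qed.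

End Orbit.

Lemma amul_is_linear a : linear (amul A a).
Proof. by move=> z x y; rewrite linearPr. Qed.

Lemma act_orbit (G : S) (P : SC) (h : hom G (cmob P)) a :
  act P a ∘ orbit h = orbit h ∘ otensr T G (linear_pack (amul_is_linear a)).
Proof.
apply: otens_ext => b.
by rewrite -compA orbit_unit -compA otensr_unit orbit_unit actM compA.
Qed.

Lemma orbit_natural (G : S) (P Q : SC) (f : hom P Q) (h : hom G (cmob P)) :
  forget f ∘ orbit h = orbit (P := Q) (forget f ∘ h).
Proof.
by apply: otens_ext => a; rewrite -compA !orbit_unit [LHS]compA -act_natural -compA.
Qed.

Lemma orbit_image (G : S) (P : SC) (h : hom G (cmob P)) :
  exists (R : SC) (i : hom R P) (x : hom G (cmob R)),
    [/\ is_mono (forget i), is_epi (orbit x) & forget i ∘ x = h].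
Proof.
have [abS _ _ _] := grS; have [_ _ hcoker _ _] := abS.
have [X [e [i [ee mi ie]]]] := image_factorization abS (orbit h).
have [Q [q qE]] := hcoker _ _ i; have /cokernelP[_ qi _] := qE.
have /kernelP[_ _ ui] := otensl_kernel H C grS (mono_kernel_cokernel abS mi qE).
(* The image is A-stable: precomposed with the epi e, the action of a becomes left multiplication on
   G ⊗ A, which stays in the image. *)
have qact a : q ∘ act P a ∘ i = 0.
  by apply: ee; rewrite -compA ie -compA act_orbit -ie -compA compA qi !comp0l.
have [r rE] : exists r, otensl T i C ∘ r = coact P ∘ i.
  apply: ui; apply: pform_jointly_monic => a.
  by rewrite comp0r -(qact a) [LHS]compA pform_natural /act !compA.
have [rA r1] : is_coaction r by apply: (@coaction_mono _ _ _ _ P _ i).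
pose R : SC := Comodule rA r1.
have [j jE] := @forget_lift _ _ _ _ R P i (esym rE).
have jx : forget j ∘ (e ∘ ounit T G A (aone A)) = h.
  by rewrite jE compA ie orbit1.
exists R, j, (e ∘ ounit T G A (aone A)); rewrite jE in jx *; split=> //.
(* The epi e is itself the orbit map of x, since both become [orbit h] after the mono i. *)
suff -> : orbit (P := R) (e ∘ ounit T G A (aone A)) = e by [].
by apply: mi; rewrite ie -jx -jE; exact: (@orbit_natural G R P j).
Qed.

(** The epi [orbit x] is the cokernel of its kernel, so [orbit p] factors through it; the factor is
    A-linear, as tested after that epi, hence colinear. *)
Lemma orbit_factor (G : S) (X P : SC) (x : hom G (cmob X)) (p : hom G (cmob P)) :
  is_epi (orbit x) ->
  (forall Z (u : hom Z (otens T G A)), orbit x ∘ u = 0 -> orbit p ∘ u = 0) ->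
  exists m : hom X P, forget m ∘ x = p.
Proof.
move=> ex xp; have [abS _ _ _] := grS; have [_ hker _ _ _] := abS.
have [N [n nE]] := hker _ _ (orbit x); have /kernelP[_ xn _] := nE.
have /cokernelP[_ _ ux] := epi_cokernel_kernel abS ex nE.
have [m mE] := ux _ _ (xp _ _ xn).
have [m' m'E] : exists m' : hom X P, forget m' = m.
  apply: act_colinear => a; apply: ex.
  by rewrite -[LHS]compA -[RHS]compA mE !act_orbit [RHS]compA mE.
by exists m'; rewrite m'E -(orbit1 x) compA mE orbit1.
Qed.

Lemma orbit_finitely_generated (G : S) (X : SC) (x : hom G (cmob X)) :
  finitely_generated G -> is_epi (orbit x) -> finitely_generated X.
Proof.
move=> fgG ex J D c fJ mD cc.
have ccS := forget_colimit grS cc.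
have mDS i j (u : shom i j) : is_mono (dmap (forget_diagram D) u).
  exact: (mono_forget grS H (mD i j u)).
have ml j : is_mono (forget (leg c j)).
  exact: (@filtered_colimit_leg_mono _ _ grS _ _ _ fJ mDS ccS j).
apply: factor_universal => // [j|f]; first exact: forget_mono.
have [j [g gE]] := finitely_generated_factor fJ ccS mDS fgG (forget f ∘ x).
(* The kernel condition for extending g to X may be tested in the apex, because the leg at j is
   monic in S. *)
have [m mE] : exists m : hom X (D j), forget m ∘ x = g.
  apply: orbit_factor => // Z u xu; apply: (ml j).
  have -> : forget (leg c j) ∘ (orbit (P := D j) g ∘ u) = forget f ∘ (orbit x ∘ u).
    by rewrite !compA !orbit_natural; congr (orbit _ ∘ u).
  by rewrite xu !comp0r.
exists j, m; apply: forget_inj; apply: ex.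
have -> : forget (leg c j ∘ m) = forget (leg c j) ∘ forget m by [].
by rewrite -compA !orbit_natural mE; congr orbit.
Qed.

(* The comodule quotients of G i ⊗ A form a small family: up to a choice they are
   indexed by the sets of morphisms G j -> G i ⊗ A that they kill. *)
Lemma orbit_generators (I : small) (G : I -> S) :
  generating G -> (forall i, finitely_generated (G i)) ->
  exists (I' : small) (G' : I' -> SC),
    generating G' /\ forall i, finitely_generated (G' i).
Proof.
move=> gG fgG.
(* As the G j generate, U determines which maps into G i ⊗ A are killed by [orbit x]. Taking values
   in [bool] and asserting only the existence of X keeps the index type small. *)
pose good (i : I) (U : forall j, hom (G j) (otens T (G i) A) -> bool)
    (X : SC) (x : hom (G i) (cmob X)) :=
  is_epi (orbit x) /\ forall j u, U j u <-> orbit x ∘ u = 0.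
pose I' : small := {a : {i : I & forall j, hom (G j) (otens T (G i) A) -> bool} |
  exists X x, good (projT1 a) (projT2 a) X x}.
have [X XE] : exists X : I' -> SC, forall a : I',
    exists x, good (projT1 (sval a)) (projT2 (sval a)) (X a) x.
  by apply: (@choice_dep I' _ (fun a X =>
    exists x, good (projT1 (sval a)) (projT2 (sval a)) X x)) => a; exact: (svalP a).
exists I', X; split=> [P Q f g fg|a]; last first.
  by have [x [ex _]] := XE a; exact: orbit_finitely_generated (fgG _) ex.
apply: forget_inj; apply: (gG) => i h.
have [R [j [y [mj ey jy]]]] := orbit_image h.
pose U l (u : hom (G l) (otens T (G i) A)) := `[< orbit h ∘ u = 0 >].
have goodU : exists X x, good i U X x.
  exists R, y; split=> // l u.
  have hu : orbit h ∘ u = forget j ∘ (orbit y ∘ u) by rewrite compA orbit_natural jy.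
  split=> [/asboolP|yu]; last by apply/asboolP; rewrite hu yu comp0r.
  by rewrite hu => jyu; apply: mj; rewrite jyu comp0r.
pose a : I' := exist _ (existT _ i U) goodU.
have [x [ex xU]] := XE a.
(* The chosen [X a] need not be the image R, but its orbit map kills the same maps from generators
   as [orbit h], so h factors through it. *)
have [m mE] : exists m : hom (X a) P, forget m ∘ x = h.
  apply: orbit_factor => // Z w xw; apply: gG => l v.
  have /asboolP wv : U l (w ∘ v) by apply/xU; rewrite compA xw comp0l.
  by rewrite comp0l -compA.
rewrite -mE !compA; congr (_ ∘ x); exact: (congr1 (@forget _ _ _ _ _ _) (fg a m)).
Qed.

End Rational.

Theorem proposition3p5 (k : fieldType) (S : lincat k)
    (T : tensoring S) (H : cotensoring T)
    (C : coalgebra k) (A : algebra k) (beta : {linear tprod C A -> k^o}) :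
  locally_finitely_generated S ->
  is_pairing beta ->
  is_rational H beta ->
  locally_finitely_generated (comodule_cat T C).
Proof.
move=> [grS [I [G [gG fgG]]]] pairing_beta rational_beta.
have [I' [G' [gG' fgG']]] := orbit_generators grS pairing_beta rational_beta gG fgG.
by split; [exact: comodule_grothendieck grS H _ _ gG' | exists I', G'].
Qed.
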